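(* Let $\lambda_1,\dots,\lambda_k\in\mathbb B_n$ and $w_1,\dots,w_k\in\mathbb C$. Then the matrix $$\left[\frac{1-w_j\overline{w_i}}{1-\langle\lambda_j,\lambda_i\rangle}\right]_{i,j=1,\dots,k}$$ is positive definite (i.e. positive semidefinite) if and only if for any $\epsilon>0$ there exists $f\in\mathcal A_n$ with $\|f\|_\infty\le1+\epsilon$ such that $f(\lambda_j)=w_j$ for every $j=1,\dots,k$.
   Context: Let $1\le n\le\aleph_0$; $\mathbb B_n$ is the open unit ball of $\mathbb C^n$ (read $\mathbb C^n$ as $\ell^2$ if $n=\aleph_0$), with inner product $\langle\lambda,\mu\rangle=\sum_i\lambda_i\overline{\mu_i}$. Let $\mathcal H_n$ be an $n$-dimensional Hilbert space with orthonormal basis $e_1,\dots,e_n$, and $\mathcal F^2=\bigoplus_{k\ge0}\mathcal H_n^{\otimes k}$ the full Fock space, $\mathcal H_n^{\otimes0}=\mathbb C1$. $\mathbb F_n^+$ is the free unital semigroup on $g_1,\dots,g_n$ with identity $e$; for $\alpha=g_{i_1}\cdots g_{i_k}$ put $e_\alpha=e_{i_1}\otimes\cdots\otimes e_{i_k}$, and $e_e=1$. The left creation operators are $S_i\psi=e_i\otimes\psi$ on $\mathcal F^2$. The noncommutative disc algebra $\mathcal A_n$ is the norm-closed subalgebra of $B(\mathcal F^2)$ generated by $S_1,\dots,S_n$ and the identity, and $\|f\|_\infty$ is the operator norm. An element $f\in\mathcal A_n$ is identified with the vector $f(S_1,\dots,S_n)1=\sum_\alpha a_\alpha e_\alpha$,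 and for $\lambda=(\lambda_1,\dots,\lambda_n)\in\mathbb B_n$, $f(\lambda):=\sum_\alpha a_\alpha\lambda_\alpha$, where $\lambda_\alpha=\lambda_{i_1}\cdots\lambda_{i_k}$ for $\alpha=g_{i_1}\cdots g_{i_k}$, $\lambda_e=1$. *)

(* Defs.v *)
From HB Require Import structures.
From mathcomp Require Import all_boot all_order all_algebra.
From mathcomp Require Import finmap complex.
From mathcomp Require Import all_classical all_reals.
From mathcomp Require Import ereal topology normedtype esum.
From mathcomp.analysis.showcase Require summability.
From mathcomp Require Import ring lra.

Set Implicit Arguments.
Unset Strict Implicit.
Unset Printing Implicit Defensive.
Import Order.TTheory GRing.Theory Num.Theory.
Import numFieldNormedType.Exports.
Local Open Scope classical_set_scope.
Local Open Scope complex_scope.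
Local Open Scope ring_scope.

Local Notation normc := ComplexField.Normc.normc.

Section SquareSum.
Context {R : realType} {I : choiceType}.
Implicit Types (x y : I -> R[i]^o) (M : R).

Definition sqsum x : \bar R := (\esum_(i in [set: I]) ((normc (x i)) ^+ 2)%:E)%E.

Definition ell2_pred : {pred I -> R[i]^o} := fun x => (sqsum x < +oo)%E.

Lemma normc_ge0 (z : R[i]) : 0 <= normc z.
Proof. by case: z => a b; exact: sqrtr_ge0. Qed.

Lemma normc_normE (z : R[i]) : `|z| = (normc z)%:C.
Proof. by case: z. Qed.

Lemma sqsum_ge0 x : (0 <= sqsum x)%E.
Proof. by apply: esum_ge0 => i _; rewrite lee_fin sqr_ge0. Qed.

Lemma sqsum_leP x M : (sqsum x <= M%:E)%E <->
  forall A : {fset I}, \sum_(i <- A) normc (x i) ^+ 2 <= M.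
Proof.
split=> [xM A|xM].
  rewrite -lee_fin; apply: le_trans xM; apply: esum_ge.
  exists [set` A]; first by split => //; exact: finite_fset.
  by rewrite fsbig_finite//= set_fsetK sumEFin.
apply: ge_ereal_sup => _ [A [finA _] <-].
by rewrite fsbig_finite//= sumEFin lee_fin.
Qed.

Lemma ell2_predP x : x \in ell2_pred <-> exists M, (sqsum x <= M%:E)%E.
Proof.
rewrite unfold_in; split=> [xoo|[M xM]]; last exact: le_lt_trans xM (ltry _).
by exists (fine (sqsum x)); rewrite fineK// ge0_fin_numE// sqsum_ge0.
Qed.

Lemma sqsumD x y (p q : R) : 0 < p -> 0 < q ->
  (sqsum x <= (p ^+ 2)%:E)%E -> (sqsum y <= (q ^+ 2)%:E)%E ->
  (sqsum (x + y)%R <= ((p + q) ^+ 2)%:E)%E.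
Proof.
move=> p0 q0 /sqsum_leP xp /sqsum_leP yq; apply/sqsum_leP => A.
have xyA : \sum_(i <- A) normc ((x + y) i) ^+ 2 <=
    (1 + q / p) * (\sum_(i <- A) normc (x i) ^+ 2) +
    (1 + p / q) * (\sum_(i <- A) normc (y i) ^+ 2).
  rewrite !mulr_sumr -big_split/=; apply: ler_sum => i _.
  have le1 : normc (x i + y i) <= normc (x i) + normc (y i) by exact: le_normcD.
  have le2 : normc (x i + y i) ^+ 2 <= (normc (x i) + normc (y i)) ^+ 2.
    by rewrite ler_sqr// nnegrE ?addr_ge0 ?normc_ge0.
  apply: le_trans le2 _; set a := normc (x i); set b := normc (y i).
  rewrite -subr_ge0.
  have -> : (1 + q / p) * a ^+ 2 + (1 + p / q) * b ^+ 2 - (a + b) ^+ 2 =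
    (q * a - p * b) ^+ 2 / (p * q) by field; rewrite !gt_eqF.
  by rewrite divr_ge0 ?sqr_ge0// ltW// mulr_gt0.
apply: le_trans xyA _.
have -> : (p + q) ^+ 2 = (1 + q / p) * p ^+ 2 + (1 + p / q) * q ^+ 2.
  by field; rewrite !gt_eqF.
by rewrite lerD// ler_wpM2l// addr_ge0// divr_ge0// ltW.
Qed.

Lemma sqsumZ x (a : R[i]) M : (sqsum x <= M%:E)%E ->
  (sqsum (a *: x)%R <= (normc a ^+ 2 * M)%:E)%E.
Proof.
move=> /sqsum_leP xM; apply/sqsum_leP => A.
rewrite (_ : \sum_(i <- A) _ = normc a ^+ 2 * \sum_(i <- A) normc (x i) ^+ 2).
  by rewrite ler_wpM2l// sqr_ge0.
rewrite mulr_sumr; apply: eq_bigr => i _.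
by rewrite -exprMn -ComplexField.Normc.normcM.
Qed.

Lemma sqsum_le_sqr x M : (sqsum x <= M%:E)%E ->
  exists2 p : R, 0 < p & (sqsum x <= (p ^+ 2)%:E)%E.
Proof.
move=> xM; have M0 : 0 <= M by rewrite -lee_fin (le_trans (sqsum_ge0 x)).
exists (1 + M); first by rewrite ltr_pwDl.
by apply: le_trans xM _; rewrite lee_fin; nra.
Qed.

Lemma ell2_submod_closed : submod_closed ell2_pred.
Proof.
split=> [|a x y /ell2_predP[M xM] /ell2_predP[N yN]].
  apply/ell2_predP; exists 0; apply/sqsum_leP => A.
  by rewrite big1// => i _; rewrite ComplexField.Normc.normc0 expr0n.
have [p p0 xp] := sqsum_le_sqr (sqsumZ a xM).
have [q q0 yq] := sqsum_le_sqr yN.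
by apply/ell2_predP; exists ((p + q) ^+ 2); exact: sqsumD.
Qed.

HB.instance Definition _ :=
  GRing.isSubmodClosed.Build R[i] (I -> R[i]^o) ell2_pred ell2_submod_closed.

End SquareSum.

(* When I has n elements, 1 <= n <= aleph_0, this is both the space C^n in which
   the unit ball lives and the Hilbert space with orthonormal basis (e_i)_{i : I}.
   For finite I the summability condition is vacuous. *)
Record ell2 (R : realType) (I : choiceType) : Type := Ell2 {
  ell2_fun :> I -> R[i]^o ;
  ell2_funP : ell2_fun \in ell2_pred }.

HB.instance Definition _ (R : realType) (I : choiceType) :=
  [isSub for @ell2_fun R I].
HB.instance Definition _ (R : realType) (I : choiceType) :=
  [Choice of ell2 R I by <:].
HB.instance Definition _ (R : realType) (I : choiceType) :=
  [SubChoice_isSubLmodule of ell2 R I by <:].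

Section Ell2Norm.
Context {R : realType} {I : choiceType}.
Implicit Types (x y : ell2 R I).

Definition ell2_norm x : R := Num.sqrt (fine (sqsum x)).

Lemma ell2_norm_ge0 x : 0 <= ell2_norm x.
Proof. exact: sqrtr_ge0. Qed.

Lemma ell2_norm_leP x (p : R) : 0 <= p ->
  ell2_norm x <= p <-> (sqsum x <= (p ^+ 2)%:E)%E.
Proof.
move=> p0; have xfin : sqsum x \is a fin_num.
  by rewrite ge0_fin_numE ?sqsum_ge0//; have := ell2_funP x; rewrite unfold_in.
rewrite -(fineK xfin) lee_fin /ell2_norm -{1}(ger0_norm p0) -sqrtr_sqr.
by rewrite ler_sqrt ?sqr_ge0.
Qed.

Lemma ell2_normD x y : ell2_norm (x + y) <= ell2_norm x + ell2_norm y.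
Proof.
apply/ler_addgt0Pr => e e0; have e20 : 0 < e / 2 by rewrite divr_gt0.
rewrite {1}(splitr e) addrACA.
have px : 0 < ell2_norm x + e / 2 by rewrite ltr_wpDl// ell2_norm_ge0.
have py : 0 < ell2_norm y + e / 2 by rewrite ltr_wpDl// ell2_norm_ge0.
apply/ell2_norm_leP; first by rewrite ltW// addr_gt0.
apply: sqsumD => //; apply/ell2_norm_leP; rewrite ?(ltW px) ?(ltW py)//;
  by rewrite lerDl ltW.
Qed.

Lemma ell2_normZ_le (a : R[i]) x : ell2_norm (a *: x) <= normc a * ell2_norm x.
Proof.
apply/ell2_norm_leP; first by rewrite mulr_ge0 ?normc_ge0 ?ell2_norm_ge0.
by rewrite exprMn; apply: sqsumZ; apply/ell2_norm_leP; rewrite ?ell2_norm_ge0.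
Qed.

Lemma ell2_normZ (a : R[i]) x : ell2_norm (a *: x) = normc a * ell2_norm x.
Proof.
apply/eqP; rewrite eq_le ell2_normZ_le/=.
have [->|a0] := eqVneq a 0.
  by rewrite ComplexField.Normc.normc0 mul0r ell2_norm_ge0.
have := ell2_normZ_le a^-1 (a *: x).
rewrite scalerA mulVf// scale1r ComplexField.Normc.normcV.
rewrite mulrC ler_pdivlMr 1?mulrC// lt_neqAle normc_ge0 andbT eq_sym.
by apply: contra_neq a0; exact: ComplexField.Normc.eq0_normc.
Qed.

Lemma ell2_norm0_eq0 x : ell2_norm x = 0 -> x = 0.
Proof.
move=> x0; apply/val_inj/funext => i /=; apply: ComplexField.Normc.eq0_normc.
have /ell2_norm_leP : ell2_norm x <= 0 by rewrite x0.
move=> /(_ (lexx _)) /sqsum_leP/(_ [fset i]%fset).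
rewrite big_seq_fset1 expr0n/= => xi.
by apply/eqP; rewrite -sqrf_eq0 eq_le xi sqr_ge0.
Qed.

Let norm x : R[i] := (ell2_norm x)%:C.

Let normD x y : norm (x + y) <= norm x + norm y.
Proof. by rewrite /norm -rmorphD/= lecR ell2_normD. Qed.

Let normZ (a : R[i]) x : norm (a *: x) = `|a| * norm x.
Proof. by rewrite /norm ell2_normZ rmorphM/= normc_normE. Qed.

Let norm0_eq0 x : norm x = 0 -> x = 0.
Proof. by move=> [] /ell2_norm0_eq0. Qed.

HB.instance Definition _ :=
  Lmodule_isNormed.Build R[i] (ell2 R I) normD normZ norm0_eq0.

Lemma ell2_normE x : `|x| = (ell2_norm x)%:C.
Proof. by []. Qed.

(* Unconditional sum, i.e. the limit of the net of finite partial sums. *)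
Definition inner x y : R[i] :=
  summability.sum (fun i : I => x i * (y i)^* : R[i]^o).

End Ell2Norm.

Section Operators.
Context {R : realType} {V : normedModType R[i]}.
Implicit Types (S T : V -> V) (A : set (V -> V)).

Definition opnorm T : \bar R :=
  ereal_sup [set (complex.Re `|T x|)%:E | x in [set x : V | `|x| <= 1]].

Definition bounded_operator : set (V -> V) :=
  [set T | linear T /\ (opnorm T < +oo)%E].

Definition closed_subalgebra A : Prop :=
  [/\ A `<=` bounded_operator,
      forall (a : R[i]) S T, A S -> A T -> A (a *: S + T),
      forall S T, A S -> A T -> A (S \o T) &
      forall T, bounded_operator T ->
        (forall e : R, 0 < e -> exists2 S, A S & (opnorm (T - S)%R <= e%:E)%E) ->
        A T].

End Operators.

(* e_{i_1} (x) ... (x) e_{i_k} is identified with the word [:: i_1; ...; i_k],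
   so that H^{(x) k} is the closed span of the words of length k, and words are an
   orthonormal basis of the full Fock space. *)
Notation fock R I := (ell2 R (seq I)).

Section FockSpace.
Context {R : realType} {I : choiceType}.

Definition word_fun (alpha : seq I) : seq I -> R[i]^o :=
  fun beta => (beta == alpha)%:R.

Lemma word_fun_ell2 alpha : word_fun alpha \in ell2_pred.
Proof.
apply/ell2_predP; exists 1; apply/sqsum_leP => A.
have [aA|aA] := boolP (alpha \in A).
  rewrite (big_fsetD1 alpha)//= /word_fun eqxx ComplexField.Normc.normc1 expr1n.
  rewrite big_seq big1 ?addr0// => b; rewrite !inE => /andP[/negPf-> _].
  by rewrite ComplexField.Normc.normc0 expr0n.
rewrite big_seq big1 ?ler01// => b bA; rewrite /word_fun.
have /negPf-> : b != alpha by apply: contraNneq aA => <-.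
by rewrite ComplexField.Normc.normc0 expr0n.
Qed.

Definition word (alpha : seq I) : fock R I := Ell2 (word_fun_ell2 alpha).

Definition creation_fun (i : I) (psi : seq I -> R[i]^o) : seq I -> R[i]^o :=
  fun alpha => if alpha is j :: beta then (j == i)%:R * psi beta else 0.

Lemma sqsum_creation i (psi : seq I -> R[i]^o) :
  sqsum (creation_fun i psi) = sqsum psi.
Proof.
rewrite /sqsum.
transitivity (\esum_(a in [set i :: b | b in [set: seq I]])
    (normc (creation_fun i psi a) ^+ 2)%:E)%E.
  rewrite [RHS]esum_mkcond; apply: eq_esum => a _.
  case: ifPn => // /negP; rewrite inE/= => ia.
  have -> : creation_fun i psi a = 0.
    case: a ia => [//|j b] ia /=.
    have /negPf-> : j != i by apply: contra_notN ia => /eqP->; exists b.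
    by rewrite mul0r.
  by rewrite ComplexField.Normc.normc0 expr0n.
rewrite (reindex_esum [set: seq I] [set i :: b | b in [set: seq I]] (cons i)).
- by apply: eq_esum => b _; rewrite /= eqxx mul1r.
- by split=> [b _ /=|b c _ _ [] //|_ [b _ <-]]; [exists b|exists b].
Qed.

Lemma creation_fun_ell2 i (psi : fock R I) :
  creation_fun i psi \in ell2_pred.
Proof. by rewrite unfold_in/= /ell2_pred sqsum_creation; case: psi. Qed.

Definition creation (i : I) (psi : fock R I) : fock R I :=
  Ell2 (creation_fun_ell2 i psi).

Lemma creation_word i alpha : creation i (word alpha) = word (i :: alpha).
Proof.
apply/val_inj/funext => -[|j b] //=; rewrite /word_fun eqseq_cons.
by case: (j == i); rewrite ?mul1r ?mul0r.
Qed.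

Lemma creation_linear i : linear (creation i).
Proof.
move=> a x y; apply/val_inj/funext => -[|j b] /=.
  by rewrite !fctE /GRing.scale/= mulr0 addr0.
by rewrite !fctE /GRing.scale/= mulrDr mulrCA.
Qed.

Lemma norm_creation i psi : `|creation i psi| = `|psi|.
Proof. by rewrite !ell2_normE /ell2_norm sqsum_creation. Qed.

Lemma creation_bounded i : bounded_operator (creation i).
Proof.
split; first exact: creation_linear.
apply: (@le_lt_trans _ _ 1%:E); last exact: ltry.
apply: ge_ereal_sup => _ [x /= x1 <-]; rewrite lee_fin.
have [->] := norm_creation i x.
by move: x1; rewrite ell2_normE -[1]/(1%:C) lecR.
Qed.

Definition disc_algebra : set (fock R I -> fock R I) :=
  smallest closed_subalgebra [set T | T = idfun \/ exists i, T = creation i].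

(* The coefficients a_alpha of f are those of the vector f 1. The sum is
   unconditional, and converges for every lambda in the open unit ball. *)
Definition point_eval (f : fock R I -> fock R I) (lambda : ell2 R I) : R[i] :=
  summability.sum (fun alpha : seq I =>
    f (word [::]) alpha * \prod_(i <- alpha) lambda i : R[i]^o).

End FockSpace.

(* Over the complex numbers, 0 <= z means that z is real and nonnegative, so
   this condition forces A to be hermitian. *)
Definition posdefmx {R : realType} {k : nat} (A : 'M[R[i]]_k) : Prop :=
  forall v : 'cV[R[i]]_k, 0 <= (map_mx Num.conj v^T *m A *m v) 0 0.

(* Main.v *)
Require Import Defs.
From mathcomp Require Import all_boot all_order all_algebra.
From mathcomp Require Import finmap complex.
From mathcomp Require Import all_classical all_reals.
From mathcomp Require Import ereal topology normedtype sequences esum.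
From mathcomp.analysis.showcase Require summability.
From mathcomp Require Import sesquilinear spectral.
From mathcomp Require Import ring lra.

Set Implicit Arguments.
Unset Strict Implicit.
Unset Printing Implicit Defensive.
Import Order.TTheory GRing.Theory Num.Theory.
Import numFieldNormedType.Exports.
Local Open Scope classical_set_scope.
Local Open Scope ring_scope.

Local Notation normc := ComplexField.Normc.normc.

(** Two facts carry the equivalence.

    Evaluation at a point lambda of the ball is the pairing with the vector
    szego lambda, whose coefficient at the word alpha is the conjugate of
    lambda_alpha.  Each S_i^* has szego lambda as an eigenvector, so
    l(T psi) = T(lambda) l(psi) for l = <., szego lambda>, first for T = S_i and
    then, because this identity passes to products, linear combinations and norm
    limits, for all T in the disc algebra (disc_algebra_eval).  Moreover
    <szego mu, szego lambda> = 1 / (1 - <lambda, mu>) (szego_kernel).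

    Necessity (posdef_pick_matrix).  For a vector v put u = sum_j conj(v_j) z_j
    and u' = sum_j conj(v_j w_j) z_j with z_j = szego lambda_j.  Then the Pick form
    at v is |u|^2 - |u'|^2, and f^* u = u' for every interpolating f, so that
    |u'| <= (1 + e) |u| for all e > 0.

    Sufficiency (interpolant_of_posdef) is a lurking isometry argument.  Factor the
    Pick matrix as B^* B and let b_i be the i-th column of B.  The definition of
    the Pick matrix says that the vectors (b_i, w_i) of C^k + C and
    (lambda_i (x) b_i, 1) of (ell2 (x) C^k) + C have the same Gram matrix; hence a
    contraction [[a, b], [c, d]] from C^k + C to (ell2 (x) C^k) + C exists whose
    transpose sends the second family to the first (pick_colligation).  Reading
    the ell2 entries of a and b as row operators L_x = sum_i x_i S_i, which satisfy
    |L_x psi| = |x| |psi| because the S_i are isometries with mutually orthogonal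
    ranges, one forms
      f = d + c (1 - rho L_a)^-1 rho L_b,     0 < rho < 1.
    Contractivity of the colligation gives |f| <= 1 (transfer_norm); the factor rho
    makes the Neumann series converge in norm, so f lies in the disc algebra itself
    and not merely in its weak closure; and f(lambda_i) tends to w_i as rho tends
    to 1 (transfer_defect).  Adding a small combination of operators of the disc
    algebra that separate the points lambda_i turns this into exact interpolation,
    at the cost of the e in the norm bound (interpolation_correction). *)

(** * Unconditional sums of complex families *)

Section Sums.
Local Existing Instance summability.totally_filter.
Context {R : realType} {I : choiceType}.
Implicit Types (x y : I -> R[i]) (s t a : R[i]) (f g : I -> R).

(** Convergence along the net of finite subsets, spelled out with real tolerances
    and the real-valued modulus. *)
Definition has_sum x s := forall e : R, 0 < e -> exists A : {fset I},
  forall B : {fset I}, (A `<=` B)%fset -> normc (s - \sum_(i <- B) x i) < e.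

Lemma ler_sum_fset f (A B : {fset I}) : (forall i, 0 <= f i) ->
  (A `<=` B)%fset -> \sum_(i <- A) f i <= \sum_(i <- B) f i.
Proof.
move=> f0 AB; pose h i := if i \in A then f i else 0.
rewrite (eq_big_seq h) => [|i]; last by rewrite /h => ->.
rewrite (@big_fset_incl _ _ _ _ _ B h)// => [|i _]; last by rewrite /h => /negPf->.
by apply: ler_sum => i _; rewrite /h; case: ifP.
Qed.

Lemma has_sumE x s : has_sum x s -> summability.sum (x : I -> R[i]^o) = s.
Proof.
move=> xs; suff : summability.partial_sum (x : I -> R[i]^o) t
    @[t --> summability.totally] --> (s : R[i]^o).
  by move=> xt; apply: (cvg_lim _ xt); exact: norm_hausdorff.
apply/cvgrPdist_lt => -[e e'] e0; move: (e0); rewrite ltcE/= => /andP[/eqP e'0 {}e0].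
have [A xA] := xs e e0; exists A => // B /= AB.
rewrite /summability.partial_sum -(big_seq_fsetE _ B predT x)/= normc_normE e'0.
by rewrite ltcR; exact: xA.
Qed.

Lemma has_sum_unique x s t : has_sum x s -> has_sum x t -> s = t.
Proof. by move=> /has_sumE <- /has_sumE. Qed.

Lemma has_sumD x y s t : has_sum x s -> has_sum y t ->
  has_sum (fun i => x i + y i) (s + t).
Proof.
move=> xs yt e e0; have e2 : 0 < e / 2 by rewrite divr_gt0.
have [[A xA] [B yB]] := (xs _ e2, yt _ e2).
exists (A `|` B)%fset => D; rewrite fsubUset => /andP[/xA xD /yB yD].
rewrite big_split/= opprD addrACA; apply: le_lt_trans (le_normcD _ _) _.
by rewrite [ltRHS]splitr ltrD.
Qed.

Lemma has_sumZ x s a : has_sum x s -> has_sum (fun i => a * x i) (a * s).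
Proof.
move=> xs e e0; have a0 : 0 < 1 + normc a by rewrite ltr_pwDl ?normc_ge0.
have [A xA] := xs (e / (1 + normc a)) (divr_gt0 e0 a0).
exists A => B /xA; rewrite ltr_pdivlMr// => xB.
rewrite -mulr_sumr -mulrBr ComplexField.Normc.normcM.
apply: le_lt_trans xB; rewrite mulrC ler_wpM2l ?normc_ge0//.
by rewrite lerDr.
Qed.

Lemma normcJ s : normc (s^*) = normc s.
Proof. by case: s => a b /=; rewrite sqrrN. Qed.

Lemma has_sumJ x s : has_sum x s -> has_sum (fun i => (x i)^*) (s^*).
Proof.
move=> xs e e0; have [A xA] := xs e e0.
by exists A => B /xA; rewrite -rmorph_sum -rmorphB/= normcJ.
Qed.

(** The finite sums increase to their supremum, which is the extended-real sum. *)
Lemma has_sum_esum f (s : R) : (forall i, 0 <= f i) ->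
  (\esum_(i in [set: I]) (f i)%:E)%E = s%:E ->
  has_sum (fun i => (f i)%:C%C) s%:C%C.
Proof.
move=> f0 fs e e0.
have fin : (\esum_(i in [set: I]) (f i)%:E)%E \is a fin_num by rewrite fs.
have [_ [A0 [finA _] <-]] := ub_ereal_sup_adherent e0 fin.
rewrite -[X in (X - _)%E]/(\esum_(i in [set: I]) (f i)%:E)%E fs.
rewrite fsbig_finite//= sumEFin -EFinB lte_fin => eA.
exists (fset_set A0) => B AB.
have le1 := ler_sum_fset f0 AB.
have le2 : \sum_(i <- B) f i <= s.
  rewrite -lee_fin -fs; apply: esum_ge; exists [set` B].
    by split => //; exact: finite_fset.
  by rewrite fsbig_finite//= set_fsetK sumEFin.
rewrite -rmorph_sum -rmorphB/= expr0n/= addr0 sqrtr_sqr ger0_norm ?subr_ge0//.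
by rewrite ltrBlDr -ltrBlDl (lt_le_trans eA).
Qed.

Lemma has_sum_supp1 x j : (forall i, i != j -> x i = 0) -> has_sum x (x j).
Proof.
move=> x0 e e0; exists [fset j]%fset => B; rewrite fsub1set => jB.
rewrite (big_fsetD1 j)//= big_seq big1 ?addr0 ?subrr ?ComplexField.Normc.normc0//.
by move=> i; rewrite !inE => /andP[/x0].
Qed.

End Sums.

Section AbsSum.
Context {R : realType} {I : choiceType}.

Lemma has_sum_bounded (f : I -> R) (M : R) : (forall i, 0 <= f i) ->
  (forall A : {fset I}, \sum_(i <- A) f i <= M) ->
  exists s : R, has_sum (fun i => (f i)%:C%C) s%:C%C.
Proof.
move=> f0 fM; exists (fine (\esum_(i in [set: I]) (f i)%:E)%E).
apply: has_sum_esum => //; rewrite fineK// ge0_fin_numE; last first.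
  by apply: esum_ge0 => i _; rewrite lee_fin.
apply: le_lt_trans (ltry M); apply: ge_ereal_sup => _ [A [finA _] <-].
by rewrite fsbig_finite//= sumEFin lee_fin.
Qed.

(** Nonnegative real families suffice, since
    z = (|z| + Re z) + i (|z| + Im z) - (1 + i) |z|
    and each of the three real families on the right is nonnegative and at most
    2 |z|. *)
Lemma has_sum_abs (z : I -> R[i]) (M : R) :
  (forall A : {fset I}, \sum_(i <- A) normc (z i) <= M) -> exists s, has_sum z s.
Proof.
move=> zM; pose r i := normc (z i).
have Re_le i : `|complex.Re (z i)| <= r i.
  have := normc_ge_Re (z i); rewrite normc_normE -lecR; exact.
have Im_le i : `|complex.Im (z i)| <= r i.
  have := normc_ge_Re (z i * 'i%C); rewrite ReiNIm normrN normc_normE lecR.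
  by rewrite ComplexField.Normc.normcM /= expr0n expr1n/= add0r sqrtr1 mulr1.
have bnd (h : I -> R) : (forall i, `|h i| <= r i) ->
    exists s : R, has_sum (fun i => (r i + h i)%:C%C) s%:C%C.
  move=> hr; apply: (@has_sum_bounded _ (M + M)) => [i|A].
    by have := hr i; rewrite ler_norml -subr_ge0 opprK addrC => /andP[].
  rewrite big_split/= lerD//; apply: le_trans (zM A).
  by apply: ler_sum => i _; apply: le_trans (hr i); exact: ler_norm.
have [s1 rRe] := bnd _ Re_le; have [s2 rIm] := bnd _ Im_le.
have [|s0 r0] := bnd (fun=> 0); first by move=> i; rewrite normr0 normc_ge0.
exists (s1%:C%C + 'i%C * s2%:C%C + (- (1 + 'i%C)) * s0%:C%C).
have := has_sumD (has_sumD rRe (has_sumZ 'i%C rIm)) (has_sumZ (- (1 + 'i%C)) r0).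
congr has_sum; apply/funext => i; rewrite [RHS]complexE addr0.
by rewrite !rmorphD/=; ring.
Qed.

End AbsSum.

(** * The inner product of square-summable families *)

Section Inner.
Context {R : realType} {I : choiceType}.
Implicit Types (x y z : ell2 R I) (a : R[i]).

Lemma ell2_sqsum x : sqsum x = (ell2_norm x ^+ 2)%:E.
Proof.
rewrite sqr_sqrtr ?fine_ge0 ?sqsum_ge0// fineK// ge0_fin_numE ?sqsum_ge0//.
by have := ell2_funP x; rewrite unfold_in.
Qed.

Lemma sqsum_fset x (A : {fset I}) : \sum_(i <- A) normc (x i) ^+ 2 <= ell2_norm x ^+ 2.
Proof. by move: A; apply/sqsum_leP; rewrite ell2_sqsum. Qed.

Lemma has_sum_inner x y : has_sum (fun i => x i * (y i)^*) (inner x y).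
Proof.
have [|s xy] := @has_sum_abs _ _ (fun i => x i * (y i)^*)
  (ell2_norm x ^+ 2 + ell2_norm y ^+ 2).
  move=> A; apply: le_trans (lerD (sqsum_fset x A) (sqsum_fset y A)).
  rewrite -big_split/=; apply: ler_sum => i _.
  rewrite ComplexField.Normc.normcM normcJ.
  have := normc_ge0 (x i); have := normc_ge0 (y i).
  move: (normc (x i)) (normc (y i)) => p q; nra.
by rewrite /inner (has_sumE xy).
Qed.

Lemma inner_linear z : scalar (inner^~ z).
Proof.
move=> a x y; apply: (has_sum_unique (has_sum_inner _ _)).
have := has_sumD (has_sumZ a (has_sum_inner x z)) (has_sum_inner y z).
congr has_sum; apply/funext => i; rewrite mulrA -mulrDl; congr (_ * _).
Qed.

Lemma innerC x y : inner y x = (inner x y)^*.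
Proof.
apply: (has_sum_unique (has_sum_inner _ _)).
have := has_sumJ (has_sum_inner x y).
by congr has_sum; apply/funext => i; rewrite rmorphM/= mulrC conjCK.
Qed.

Lemma mulJ (a : R[i]) : a * a^* = (normc a ^+ 2)%:C%C.
Proof. by rewrite -sqr_normc normc_normE rmorphXn. Qed.

Lemma conj_realC (r : R) : (r%:C%C)^* = r%:C%C.
Proof. exact: conjc_real. Qed.

Lemma inner_norm x : inner x x = (ell2_norm x ^+ 2)%:C%C.
Proof.
apply: (has_sum_unique (has_sum_inner _ _)).
have := has_sum_esum (fun i => sqr_ge0 (normc (x i))) (ell2_sqsum x).
by congr has_sum; apply/funext => i; rewrite mulJ.
Qed.

Lemma innerDl x y z : inner (x + y) z = inner x z + inner y z.
Proof. by have := inner_linear z 1 x y; rewrite scale1r mul1r. Qed.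

Lemma inner0l z : inner 0 z = 0.
Proof. by apply: (addrI (inner 0 z)); rewrite -innerDl !addr0. Qed.

Lemma innerZl a x z : inner (a *: x) z = a * inner x z.
Proof. by have := inner_linear z a x 0; rewrite inner0l !addr0. Qed.

Lemma innerBl x y z : inner (x - y) z = inner x z - inner y z.
Proof. by rewrite innerDl -scaleN1r innerZl mulN1r. Qed.

Lemma inner_suml (J : Type) (r : seq J) (F : J -> ell2 R I) z :
  inner (\sum_(j <- r) F j) z = \sum_(j <- r) inner (F j) z.
Proof. exact: (big_morph (inner^~ z) (fun x y => innerDl x y z) (inner0l z)). Qed.

Lemma innerDr x y z : inner x (y + z) = inner x y + inner x z.
Proof. by rewrite innerC innerDl rmorphD/= -!innerC. Qed.

Lemma innerZr a x z : inner x (a *: z) = a^* * inner x z.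
Proof. by rewrite innerC innerZl rmorphM/= -innerC. Qed.

Lemma innerBr x y z : inner x (y - z) = inner x y - inner x z.
Proof. by rewrite innerC innerBl rmorphB/= -!innerC. Qed.

Lemma inner0r z : inner z 0 = 0.
Proof. by rewrite innerC inner0l rmorph0. Qed.

Lemma inner_sumr (J : Type) (r : seq J) (F : J -> ell2 R I) z :
  inner z (\sum_(j <- r) F j) = \sum_(j <- r) inner z (F j).
Proof.
by rewrite innerC inner_suml rmorph_sum; apply: eq_bigr => j _; rewrite /= -innerC.
Qed.

Lemma normc_real (a : R) : normc a%:C%C = `|a|.
Proof. by rewrite /= expr0n addr0 sqrtr_sqr. Qed.

Lemma ell2_norm0 : ell2_norm (0 : ell2 R I) = 0.
Proof. by have [] := normr0 (ell2 R I). Qed.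

(** Expanding the square of v = |y|^2 x - <x, y> y gives
    |v|^2 = |y|^2 (|y|^2 |x|^2 - |<x, y>|^2). *)
Lemma cauchy_schwarz x y : normc (inner x y) <= ell2_norm x * ell2_norm y.
Proof.
have [y0|y0] := eqVneq (ell2_norm y) 0.
  rewrite (ell2_norm0_eq0 y0) inner0r ComplexField.Normc.normc0.
  by rewrite ell2_norm0 mulr0.
set N := ell2_norm y; set t := inner x y.
have yN : inner y y = (N ^+ 2)%:C%C := inner_norm y.
pose v := (N ^+ 2)%:C%C *: x - t *: y.
have : inner v v = (N ^+ 2 * (N ^+ 2 * ell2_norm x ^+ 2 - normc t ^+ 2))%:C%C.
  rewrite {1}/v innerBl !innerZl /v -scaleN1r scalerA !innerDr !innerZr.
  rewrite !inner_norm -/N (innerC x y) -/t !rmorphM/= !rmorphB/= rmorphN rmorph1.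
  rewrite !conj_realC -mulJ rmorphM !rmorphXn/=; ring.
rewrite inner_norm => /complexI v2.
have : 0 <= N ^+ 2 * (N ^+ 2 * ell2_norm x ^+ 2 - normc t ^+ 2).
  by rewrite -v2 sqr_ge0.
rewrite pmulr_rge0 ?exprn_gt0// ?lt_neqAle ?ell2_norm_ge0 1?eq_sym ?y0//.
rewrite subr_ge0 -exprMn ler_sqr ?nnegrE ?normc_ge0 ?mulr_ge0 ?ell2_norm_ge0//.
by rewrite mulrC.
Qed.

End Inner.

(** * The orthonormal basis and density of finite combinations *)

Section Basis.
Context {R : realType} {I : choiceType}.
Implicit Types (x y z : ell2 R I) (a : R[i]).

Lemma ell2_norm_sum (J : Type) (r : seq J) (F : J -> ell2 R I) :
  ell2_norm (\sum_(j <- r) F j) <= \sum_(j <- r) ell2_norm (F j).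
Proof.
elim/big_ind2 : _ => [|x p y q xp yq|//]; first by rewrite ell2_norm0.
by apply: le_trans (ell2_normD _ _) (lerD xp yq).
Qed.

Lemma sqsum_conj x : sqsum (fun i => (x i)^*) = sqsum x.
Proof. by apply: eq_esum => i _; rewrite normcJ. Qed.

Lemma conj_ell2 x : (fun i => (x i)^*) \in @ell2_pred R I.
Proof. by rewrite unfold_in /ell2_pred sqsum_conj; exact: ell2_funP. Qed.

Definition ell2_conj x : ell2 R I := Ell2 (conj_ell2 x).

Lemma ell2_norm_conj x : ell2_norm (ell2_conj x) = ell2_norm x.
Proof. by rewrite /ell2_norm sqsum_conj. Qed.

Lemma inner_conj x y : inner (ell2_conj x) (ell2_conj y) = inner y x.
Proof.
rewrite [RHS]innerC; apply: (has_sum_unique (has_sum_inner _ _)).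
have := has_sumJ (has_sum_inner x y).
by congr has_sum; apply/funext => i; rewrite rmorphM.
Qed.

Lemma delta_ell2 (j : I) : (fun i => (i == j)%:R) \in @ell2_pred R I.
Proof.
apply/ell2_predP; exists 1; apply/sqsum_leP => A.
have supp i : i != j -> normc ((i == j)%:R : R[i]) ^+ 2 = 0.
  by move=> /negPf->; rewrite ComplexField.Normc.normc0 expr0n.
have [jA|jA] := boolP (j \in A).
  rewrite (big_fsetD1 j)//= eqxx ComplexField.Normc.normc1 expr1n.
  by rewrite big_seq big1 ?addr0// => i; rewrite !inE => /andP[/supp].
rewrite big_seq big1 ?ler01// => i iA; apply: supp.
by apply: contraNneq jA => <-.
Qed.

Definition delta (j : I) : ell2 R I := Ell2 (delta_ell2 j).

Lemma inner_delta x j : inner x (delta j) = x j.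
Proof.
have := @has_sum_supp1 R I (fun i => x i * (delta j i)^*) j.
rewrite /= eqxx rmorph1 mulr1 => xj.
apply: (has_sum_unique (has_sum_inner _ _)); apply: xj => i /negPf->.
by rewrite rmorph0 mulr0.
Qed.

Lemma ell2_sumE (J : Type) (r : seq J) (F : J -> ell2 R I) t :
  (\sum_(j <- r) F j) t = \sum_(j <- r) F j t.
Proof.
rewrite -inner_delta inner_suml; apply: eq_bigr => j _.
by rewrite inner_delta.
Qed.

Lemma ell2_addE (x y : ell2 R I) t : (x + y) t = x t + y t.
Proof. by []. Qed.

Lemma ell2_scaleE s (x : ell2 R I) t : (s *: x) t = s * x t.
Proof. by []. Qed.

Lemma ell2P (x y : ell2 R I) : (forall t, x t = y t) -> x = y.
Proof. by move=> xy; apply/val_inj/funext. Qed.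

(** The remainder has squared norm |x|^2 - sum_(i in A) |x_i|^2 by orthonormality. *)
Lemma ell2_truncation x (e : R) : 0 < e -> exists A : {fset I},
  ell2_norm (x - \sum_(i <- A) x i *: delta i) <= e.
Proof.
move=> e0; have e20 : 0 < e ^+ 2 by rewrite exprn_gt0.
have [A xA] := has_sum_esum (fun i => sqr_ge0 (normc (x i))) (ell2_sqsum x) e20.
exists A; set s := \sum_(i <- A) _.
pose q := \sum_(i <- A) normc (x i) ^+ 2.
have sx : inner s x = q%:C%C.
  rewrite inner_suml rmorph_sum; apply: eq_bigr => i _.
  by rewrite innerZl innerC inner_delta mulJ.
have ss : inner s s = q%:C%C.
  rewrite {2}/s inner_sumr rmorph_sum; apply: eq_big_seq => i iA.
  rewrite innerZr inner_delta -[RHS]mulJ mulrC; congr (_ * _).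
  rewrite -inner_delta inner_suml (bigD1_seq i)//= innerZl inner_delta /= eqxx mulr1.
  rewrite big1 ?addr0// => j ji; rewrite innerZl inner_delta /=.
  by rewrite eq_sym (negPf ji) mulr0.
have : inner (x - s) (x - s) = (ell2_norm x ^+ 2 - q)%:C%C.
  rewrite innerBl !innerBr inner_norm sx ss subrr subr0.
  by rewrite [inner x s]innerC sx conj_realC -rmorphB.
rewrite inner_norm => /complexI xs2.
have /ltW := xA A (fsubset_refl _).
rewrite -rmorph_sum -/q -(rmorphB (real_complex R)) normc_real -xs2.
by rewrite ger0_norm ?sqr_ge0// ler_sqr ?nnegrE ?ell2_norm_ge0// ltW.
Qed.

(** An identity between bounded functionals therefore has to be checked on basis
    vectors only; this replaces reindexing of complex sums below. *)
Lemma functional_eq0 (phi : ell2 R I -> R[i]) (M : R) : scalar phi ->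
  (forall x, normc (phi x) <= M * ell2_norm x) ->
  (forall j, phi (delta j) = 0) -> forall x, phi x = 0.
Proof.
move=> phiL phiM phi_delta x; apply: ComplexField.Normc.eq0_normc.
apply/eqP; rewrite eq_le normc_ge0 andbT; apply/ler_addgt0Pl => e e0.
rewrite addr0.
have M0 : 0 < 1 + `|M| by rewrite ltr_pwDl.
have [A xA] := ell2_truncation x (divr_gt0 e0 M0).
have phi0 : phi 0 = 0.
  by have := phiL (-1) 0 0; rewrite scaler0 addr0 mulN1r addNr.
have phiD u v : phi (u + v) = phi u + phi v.
  by have := phiL 1 u v; rewrite scale1r mul1r.
have phiZ a u : phi (a *: u) = a * phi u.
  by have := phiL a u 0; rewrite phi0 !addr0.
set s := \sum_(i <- A) _ in xA.
have s0 : phi s = 0.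
  rewrite (big_morph phi phiD phi0) big1// => i _.
  by rewrite phiZ phi_delta mulr0.
rewrite -(subrK s x) phiD s0 addr0; apply: le_trans (phiM _) _.
have := xA; rewrite ler_pdivlMr//; apply: le_trans.
by rewrite mulrC ler_wpM2l ?ell2_norm_ge0// ler_wpDl// ler_norm.
Qed.

End Basis.

(** * Sums over words *)

Section Words.
Context {R : realType} {I : choiceType}.

(** A word is empty or a letter followed by a word. *)
Lemma esum_words (F : seq I -> \bar R) : (forall alpha, 0 <= F alpha)%E ->
  (\esum_(alpha in [set: seq I]) F alpha = F [::] +
    \esum_(beta in [set: seq I]) \esum_(i in [set: I]) F (i :: beta))%E.
Proof.
move=> F0; rewrite (esumID [set [::]])// !setTI esum_set1//; congr (_ + _)%E.
rewrite (esum_esum (a := fun beta i => F (i :: beta)))//.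
apply: reindex_esum; split=> [[b i] _ //|[b i] [c j] _ _ /= [-> ->] //|].
by move=> [|i b] h; [exfalso; exact: h|exists (b, i)].
Qed.

Lemma sqsum_words (u : seq I -> R[i]^o) : sqsum u = ((normc (u [::]) ^+ 2)%:E +
  \esum_(beta in [set: seq I]) sqsum (fun i => u (i :: beta)))%E.
Proof. by apply: esum_words => a; rewrite lee_fin sqr_ge0. Qed.

End Words.

Section Growth.
Context {R : realType}.

Lemma esum_leP (T : choiceType) (f : T -> R) (M : R) : (forall t, 0 <= f t) ->
  ((\esum_(t in [set: T]) (f t)%:E)%E <= M%:E)%E <->
  forall A : {fset T}, \sum_(t <- A) f t <= M.
Proof.
move=> f0; split=> [fM A|fM].
  rewrite -lee_fin; apply: le_trans fM; apply: esum_ge.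
  exists [set` A]; first by split => //; exact: finite_fset.
  by rewrite fsbig_finite//= set_fsetK sumEFin.
apply: ge_ereal_sup => _ [A [finA _] <-].
by rewrite fsbig_finite//= sumEFin lee_fin.
Qed.

(** If passing to words that are one letter longer multiplies the mass by at most
    theta < 1, up to a summable source c, then the mass K_N carried by words of
    length less than N satisfies K_(N+1) <= g [::] + theta (K_N + C), and the bound
    is the fixed point of this recursion.  This is how the Szego vectors and the
    resolvent below are seen to be square-summable. *)
Lemma sum_words_le (I : choiceType) (g c : seq I -> R) (theta C : R) :
  0 <= theta < 1 -> (forall alpha, 0 <= g alpha) -> (forall alpha, 0 <= c alpha) ->
  (forall A : {fset seq I}, \sum_(alpha <- A) c alpha <= C) ->
  (forall beta, (\esum_(i in [set: I]) (g (i :: beta))%:E <=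
    (theta * (g beta + c beta))%:E)%E) ->
  forall A : {fset seq I},
    \sum_(alpha <- A) g alpha <= (g [::] + theta * C) / (1 - theta).
Proof.
move=> /andP[th0 th1] g0 c0 cC gS A; set K := _ / _.
have th1' : 0 < 1 - theta by rewrite subr_gt0.
have C0 : 0 <= C by have := cC fset0; rewrite big_seq_fset0.
have KE : g [::] + theta * (K + C) = K.
  by rewrite /K; field; rewrite gt_eqF.
have K0 : 0 <= K by rewrite divr_ge0 ?(ltW th1')// addr_ge0// mulr_ge0.
pose gN N alpha : R := if (size alpha < N)%N then g alpha else 0.
have gN0 N alpha : 0 <= gN N alpha by rewrite /gN; case: ifP.
have main N : (\esum_(alpha in [set: seq I]) (gN N alpha)%:E <= K%:E)%E.
  elim: N => [|N IHN]; first by rewrite esum1// lee_fin.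
  rewrite esum_words => [|alpha]; last by rewrite lee_fin.
  rewrite -KE EFinD leeD//.
  apply: (@le_trans _ _
    (\esum_(beta in [set: seq I]) (theta * (gN N beta + c beta))%:E)%E).
    apply: le_esum => beta _; rewrite /gN/= ltnS; case: ifP => _; first exact: gS.
    by rewrite esum1// lee_fin add0r mulr_ge0.
  apply/esum_leP => [beta|B]; first by rewrite mulr_ge0 ?addr_ge0.
  rewrite -mulr_sumr ler_wpM2l// big_split/= lerD//.
  by move: B; apply/esum_leP.
pose N := (\max_(alpha <- A) size alpha).+1.
rewrite (eq_big_seq (gN N)) => [|alpha aA]; last first.
  rewrite /gN ifT// ltnS; exact: leq_bigmax_seq.
by move: (A); apply/esum_leP.
Qed.

End Growth.

(** * Bounded operators and the disc algebra *)

Section BoundedOperators.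
Context {R : realType} {I : choiceType}.
Implicit Types (T U : fock R I -> fock R I) (psi z : fock R I) (c : R).

Lemma linear_map0 T : linear T -> T 0 = 0.
Proof.
by move=> TL; have := TL (-1) 0 0; rewrite scaler0 addr0 scaleN1r addNr.
Qed.

Lemma linear_mapZ T : linear T -> forall a psi, T (a *: psi) = a *: T psi.
Proof. by move=> TL a psi; have := TL a psi 0; rewrite (linear_map0 TL) !addr0. Qed.

Lemma linear_mapB T : linear T -> forall x y, T (x - y) = T x - T y.
Proof.
by move=> TL x y; rewrite addrC -scaleN1r TL scaleN1r addrC.
Qed.

Lemma opnorm_leP T c : linear T -> 0 <= c -> (opnorm T <= c%:E)%E <->
  forall psi, ell2_norm (T psi) <= c * ell2_norm psi.
Proof.
move=> TL c0; split=> [Tc psi|Tc]; last first.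
  apply: ge_ereal_sup => _ [psi /= psi1 <-]; rewrite lee_fin.
  apply: le_trans (Tc psi) _; rewrite -[leRHS]mulr1 ler_wpM2l//.
  by move: psi1; rewrite ell2_normE -[1]/(1%:C%C) lecR.
have [->|psi0] := eqVneq psi 0; first by rewrite (linear_map0 TL) !ell2_norm0 mulr0.
have N0 : 0 < ell2_norm psi.
  rewrite lt_neqAle ell2_norm_ge0 andbT eq_sym; apply: contra_neq psi0.
  exact: ell2_norm0_eq0.
pose phi := ((ell2_norm psi)^-1)%:C%C *: psi.
have phi1 : ell2_norm phi = 1.
  by rewrite ell2_normZ normc_real ger0_norm ?invr_ge0 ?ltW// mulVf// gt_eqF.
have : ((ell2_norm (T phi))%:E <= c%:E)%E.
  apply: le_trans Tc; apply: ereal_sup_ubound; exists phi => //=.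
  by rewrite ell2_normE phi1.
rewrite lee_fin (linear_mapZ TL) ell2_normZ normc_real ger0_norm ?invr_ge0 ?(ltW N0)//.
by rewrite ler_pdivrMl// mulrC.
Qed.

Lemma bounded_operatorP T : bounded_operator T <-> linear T /\
  exists2 c, 0 <= c & forall psi, ell2_norm (T psi) <= c * ell2_norm psi.
Proof.
split=> [[TL Too]|[TL [c c0 Tc]]]; split => //; last first.
  by apply: le_lt_trans (ltry c); apply/opnorm_leP.
have T0 : (0 <= opnorm T)%E.
  apply: ereal_sup_ubound; exists 0; first by rewrite /= normr0.
  by rewrite (linear_map0 TL) normr0.
exists (fine (opnorm T)); first by rewrite fine_ge0.
by apply/opnorm_leP; rewrite ?fine_ge0// fineK// ge0_fin_numE.
Qed.

Lemma sumfunE (T : Type) (V : zmodType) (J : Type) (r : seq J) (F : J -> T -> V) x :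
  (\sum_(j <- r) F j) x = \sum_(j <- r) F j x.
Proof. by elim/big_rec2 : _ => [//|j v f _ <-]. Qed.

Lemma disc_algebra_id : disc_algebra (idfun : fock R I -> fock R I).
Proof. by move=> A [_]; apply; left. Qed.

Lemma disc_algebra_creation i : disc_algebra (@creation R I i).
Proof. by move=> A [_]; apply; right; exists i. Qed.

Lemma disc_algebra_lin a T U : disc_algebra T -> disc_algebra U ->
  disc_algebra (a *: T + U).
Proof.
move=> dT dU A cA; have [_ lin _ _] := cA.1.
by apply: lin; [exact: dT|exact: dU].
Qed.

Lemma disc_algebra_comp T U : disc_algebra T -> disc_algebra U ->
  disc_algebra (T \o U).
Proof.
move=> dT dU A cA; have [_ _ comp _] := cA.1.
by apply: comp; [exact: dT|exact: dU].
Qed.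

Lemma disc_algebra0 : disc_algebra (0 : fock R I -> fock R I).
Proof.
have := disc_algebra_lin (-1) disc_algebra_id disc_algebra_id.
by rewrite scaleN1r addNr.
Qed.

Lemma disc_algebra_sum (J : Type) (r : seq J) (c : J -> R[i])
    (T : J -> fock R I -> fock R I) : (forall j, disc_algebra (T j)) ->
  disc_algebra (\sum_(j <- r) c j *: T j).
Proof.
move=> dT; elim: r => [|j r IHr]; first by rewrite big_nil; exact: disc_algebra0.
by rewrite big_cons; exact: disc_algebra_lin.
Qed.

Lemma disc_algebra_scale (s : R[i]) (T : fock R I -> fock R I) :
  disc_algebra T -> disc_algebra (s *: T).
Proof.
by move=> dT; rewrite -[s *: T]addr0; apply: disc_algebra_lin => //; exact: disc_algebra0.
Qed.

Lemma disc_algebra_add (T U : fock R I -> fock R I) :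
  disc_algebra T -> disc_algebra U -> disc_algebra (T + U).
Proof. by move=> dT dU; rewrite -[T]scale1r; exact: disc_algebra_lin. Qed.

(** The bounded operators T whose adjoint has z as an eigenvector, with the conjugate
    of <T 1, z> as eigenvalue. *)
Definition multiplicative_at z : set (fock R I -> fock R I) :=
  [set T | bounded_operator T /\
    forall psi, inner (T psi) z = inner (T (word [::])) z * inner psi z].

(** In the norm limit the defect l(T psi) - l(T 1) l(psi), with l = <., z>, differs
    from that of an approximant S by terms of size |T - S|. *)
Lemma multiplicative_at_closed z : closed_subalgebra (multiplicative_at z).
Proof.
split=> [T []//|a S T [/bounded_operatorP[SL [c c0 Sc]] Sm]|S T|T bT limT].
- move=> [/bounded_operatorP[TL [d d0 Td]] Tm]; split.
    apply/bounded_operatorP; split=> [b x y|].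
      rewrite !fctE SL TL !scalerDr addrACA; congr (_ + _ + _).
      by rewrite !scalerA mulrC.
    exists (normc a * c + d) => [|psi]; first by rewrite addr_ge0 ?mulr_ge0 ?normc_ge0.
    apply: le_trans (ell2_normD _ _) _; rewrite ell2_normZ mulrDl lerD//.
    by rewrite -mulrA ler_wpM2l ?normc_ge0.
  by move=> psi; rewrite !fctE !innerDl !innerZl Sm Tm; ring.
- move=> [/bounded_operatorP[SL [c c0 Sc]] Sm].
  move=> [/bounded_operatorP[TL [d d0 Td]] Tm]; split.
    apply/bounded_operatorP; split=> [b x y|]; first by rewrite /= TL SL.
    exists (c * d) => [|psi]; first by rewrite mulr_ge0.
    by apply: le_trans (Sc _) _; rewrite -mulrA ler_wpM2l.
  by move=> psi /=; rewrite Sm Tm [in RHS]Sm mulrA.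
- have [TL _] := bT; split => // psi; apply/eqP; rewrite -subr_eq0; apply/eqP.
  apply: ComplexField.Normc.eq0_normc; apply/eqP; rewrite eq_le normc_ge0 andbT.
  apply/ler_addgt0Pl => e e0; rewrite addr0.
  (* K - 1 bounds the defect of T per unit of |T - S|. *)
  pose K := 1 + (ell2_norm psi * ell2_norm z +
     ell2_norm (word [::] : fock R I) * ell2_norm z * (ell2_norm psi * ell2_norm z)).
  have K0 : 0 < K.
    by rewrite ltr_pwDl// addr_ge0 ?mulr_ge0 ?ell2_norm_ge0// mulr_ge0.
  have [S [bS Sm] TS] := limT (e / K) (divr_gt0 e0 K0).
  have TSL : linear (T - S).
    move=> a x y; rewrite !fctE TL bS.1 scalerBr opprD.
    by rewrite addrACA.
  have TS' phi : normc (inner (T phi) z - inner (S phi) z) <=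
      e / K * (ell2_norm phi * ell2_norm z).
    rewrite -innerBl; apply: le_trans (cauchy_schwarz _ _) _.
    rewrite mulrA ler_wpM2r ?ell2_norm_ge0//.
    by move: phi; apply/(opnorm_leP TSL); rewrite // divr_ge0// ltW.
  have -> : inner (T psi) z - inner (T (word [::])) z * inner psi z =
      (inner (T psi) z - inner (S psi) z) -
      (inner (T (word [::])) z - inner (S (word [::])) z) * inner psi z.
    by rewrite (Sm psi); ring.
  apply: le_trans (le_normcD _ _) _; rewrite normcN ComplexField.Normc.normcM.
  apply: (@le_trans _ _ (e / K * (K - 1))); last first.
    rewrite mulrBr mulr1 divfK ?gt_eqF// gerBl divr_ge0// ltW//.
  rewrite {2}/K addrAC subrr add0r mulrDr lerD//.
  rewrite [leRHS]mulrA; apply: ler_pM; rewrite ?normc_ge0//.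
  exact: cauchy_schwarz.
Qed.

Lemma disc_algebra_multiplicative z : inner (word [::]) z = 1 ->
  (forall i psi, inner (creation i psi) z = inner (creation i (word [::])) z * inner psi z) ->
  forall T, disc_algebra T -> multiplicative_at z T.
Proof.
move=> z1 zS T; apply; split; first exact: multiplicative_at_closed.
move=> _ [->|[i ->]]; split => //; [|by move=> psi; rewrite z1 mul1r|exact: creation_bounded].
apply/bounded_operatorP; split => //; exists 1 => // psi.
by rewrite mul1r.
Qed.

(** At z = 0 the multiplicativity condition is vacuous, which leaves boundedness. *)
Lemma disc_algebra_bounded T : disc_algebra T -> bounded_operator T.
Proof.
move=> dT; suff [] : multiplicative_at 0 T by [].
apply: dT; split; first exact: multiplicative_at_closed.
move=> _ [->|[i ->]]; split=> [|psi]; rewrite ?inner0r ?mulr0//;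
  last exact: creation_bounded.
by apply/bounded_operatorP; split => //; exists 1 => // psi; rewrite mul1r.
Qed.

Lemma disc_algebra_lim T : bounded_operator T ->
  (forall e : R, 0 < e -> exists2 S, disc_algebra S &
     forall psi, ell2_norm (T psi - S psi) <= e * ell2_norm psi) ->
  disc_algebra T.
Proof.
move=> bT limT A hA; have [_ _ _ Alim] := hA.1; apply: Alim => // e e0.
have [S dS TS] := limT e e0; exists S; first exact: dS.
have [SL _] : bounded_operator S by exact: (disc_algebra_bounded dS).
apply/opnorm_leP => //; last exact: ltW.
by move=> a x y; rewrite !fctE bT.1 SL scalerBr opprD addrACA.
Qed.

End BoundedOperators.

(** * Row operators *)

Section RowCreation.
Context {R : realType} {I : choiceType}.
Implicit Types (a b : ell2 R I) (psi : fock R I).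

(** The operator sum_i a_i S_i, for square-summable a. *)
Definition row_creation_fun a (psi : seq I -> R[i]^o) : seq I -> R[i]^o :=
  fun alpha => if alpha is i :: beta then a i * psi beta else 0.

(** The S_i are isometries with mutually orthogonal ranges, so sum_i a_i S_i is |a|
    times an isometry. *)
Lemma sqsum_row_creation a psi :
  sqsum (row_creation_fun a psi) = ((ell2_norm a * ell2_norm psi) ^+ 2)%:E.
Proof.
rewrite sqsum_words.
have -> : normc (row_creation_fun a psi [::]) = 0 by exact: ComplexField.Normc.normc0.
rewrite expr0n add0e.
transitivity (sqsum ((ell2_norm a)%:C%C *: psi : fock R I)); last first.
  by rewrite ell2_sqsum ell2_normZ normc_real ger0_norm ?ell2_norm_ge0.
apply: eq_esum => beta _.
transitivity (sqsum (psi beta *: a : ell2 R I)).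
  by apply: eq_esum => i _; rewrite /= mulrC.
rewrite ell2_sqsum ell2_normZ ComplexField.Normc.normcM normc_real.
by rewrite ger0_norm ?ell2_norm_ge0// mulrC.
Qed.

Lemma row_creation_ell2 a psi : row_creation_fun a psi \in @ell2_pred R (seq I).
Proof. by rewrite unfold_in /ell2_pred sqsum_row_creation ltry. Qed.

Definition row_creation a psi : fock R I := Ell2 (row_creation_ell2 a psi).

Lemma row_creation_norm a psi :
  ell2_norm (row_creation a psi) = ell2_norm a * ell2_norm psi.
Proof.
rewrite /ell2_norm sqsum_row_creation /= sqrtr_sqr ger0_norm//.
by rewrite mulr_ge0 ?ell2_norm_ge0.
Qed.

Lemma row_creation_linear a : linear (row_creation a).
Proof.
move=> c x y; apply/val_inj/funext => -[|j b]; rewrite /= !fctE /GRing.scale/=.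
  by rewrite mulr0 addr0.
by rewrite mulrDr mulrCA.
Qed.

Lemma row_creationDl c a b psi :
  row_creation (c *: a + b) psi = c *: row_creation a psi + row_creation b psi.
Proof.
apply/val_inj/funext => -[|j d]; rewrite /= !fctE /GRing.scale/=.
  by rewrite mulr0 addr0.
by rewrite mulrDl mulrA.
Qed.

Lemma row_creation_delta i : row_creation (delta i) = creation i.
Proof. by apply/funext => psi; apply/val_inj/funext => -[]. Qed.

Lemma row_creation_bounded a : bounded_operator (row_creation a).
Proof.
apply/bounded_operatorP; split; first exact: row_creation_linear.
by exists (ell2_norm a) => [|psi]; rewrite ?ell2_norm_ge0// row_creation_norm.
Qed.

(** The norm of sum_i a_i S_i is |a|, so truncating a in ell2 approximates the
    operator in norm by finite combinations of the S_i. *)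
Lemma disc_algebra_row_creation a : disc_algebra (row_creation a).
Proof.
apply: disc_algebra_lim; first exact: row_creation_bounded.
move=> e e0; have [A aA] := ell2_truncation a e0.
exists (\sum_(i <- A) a i *: creation i).
  by apply: disc_algebra_sum => i; exact: disc_algebra_creation.
have -> : \sum_(i <- A) a i *: creation i =
    row_creation (\sum_(i <- A) a i *: delta i).
  elim/big_rec2 : _ => [|i b T _ ->]; apply/funext => psi.
    apply/val_inj/funext => -[|j d] //=.
    by rewrite mul0r.
  by rewrite row_creationDl row_creation_delta.
move=> psi; rewrite -scaleN1r addrC -row_creationDl scaleN1r addrC.
by rewrite row_creation_norm ler_wpM2r ?ell2_norm_ge0.
Qed.

End RowCreation.

(** * Szego vectors and point evaluation *)

Section Szego.
Context {R : realType} {I : choiceType}.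
Implicit Types (lambda mu : ell2 R I) (psi : fock R I).

(** The words i :: beta carry |lambda|^2 times the mass of beta. *)
Lemma szego_ell2 lambda : ell2_norm lambda < 1 ->
  (fun alpha : seq I => (\prod_(i <- alpha) lambda i)^*) \in @ell2_pred R (seq I).
Proof.
move=> l1; pose g (alpha : seq I) := normc (\prod_(i <- alpha) lambda i) ^+ 2.
have g0 alpha : 0 <= g alpha by exact: sqr_ge0.
apply/ell2_predP; exists ((g [::] + ell2_norm lambda ^+ 2 * 0) /
  (1 - ell2_norm lambda ^+ 2)).
apply/sqsum_leP => A; under eq_bigr do rewrite normcJ.
move: A; apply: (@sum_words_le _ _ g (fun=> 0)) => // [|A|beta].
- by rewrite sqr_ge0/= expr_lt1 ?ell2_norm_ge0.
- by rewrite big1.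
- rewrite addr0 mulrC -exprMn -ell2_normZ -ell2_sqsum le_eqVlt; apply/orP; left.
  apply/eqP; apply: eq_esum => i _; by rewrite /g big_cons mulrC.
Qed.

Definition szego lambda (lambda1 : ell2_norm lambda < 1) : fock R I :=
  Ell2 (szego_ell2 lambda1).

Lemma wordE (alpha : seq I) : word alpha = delta alpha :> fock R I.
Proof. exact: val_inj. Qed.

Lemma inner_szego_word lambda (lambda1 : ell2_norm lambda < 1) alpha :
  inner (word alpha) (szego lambda1) = \prod_(i <- alpha) lambda i.
Proof. by rewrite innerC wordE inner_delta conjCK. Qed.

Lemma point_evalE lambda (lambda1 : ell2_norm lambda < 1) (f : fock R I -> fock R I) :
  point_eval f lambda = inner (f (word [::])) (szego lambda1).
Proof.
rewrite /point_eval /inner; apply: (f_equal (@summability.sum _ _ (R[i]^o : normedModType R[i]))).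
apply/funext => alpha.
by rewrite /= conjCK.
Qed.

Lemma inner_szego_creation lambda (lambda1 : ell2_norm lambda < 1) i psi :
  inner (creation i psi) (szego lambda1) = lambda i * inner psi (szego lambda1).
Proof.
set z := szego lambda1; apply/eqP; rewrite -subr_eq0; apply/eqP.
apply: (@functional_eq0 _ _
  (fun psi => inner (creation i psi) z - lambda i * inner psi z)
  (ell2_norm z + normc (lambda i) * ell2_norm z)).
- move=> a x y; rewrite creation_linear !innerDl !innerZl; ring.
- move=> x; apply: le_trans (le_normcD _ _) _.
  rewrite normcN ComplexField.Normc.normcM mulrDl lerD//.
    apply: le_trans (cauchy_schwarz _ _) _; rewrite mulrC ler_wpM2l ?ell2_norm_ge0//.
    by rewrite /ell2_norm sqsum_creation.
  rewrite -mulrA ler_wpM2l ?normc_ge0// mulrC; exact: cauchy_schwarz.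
- by move=> alpha; rewrite -wordE creation_word !inner_szego_word big_cons subrr.
Qed.

(** Evaluation at a point of the ball is a character of the disc algebra which is
    implemented by the Szego vector. *)
Lemma disc_algebra_eval lambda (lambda1 : ell2_norm lambda < 1) T psi :
  disc_algebra T ->
  inner (T psi) (szego lambda1) = point_eval T lambda * inner psi (szego lambda1).
Proof.
rewrite (point_evalE lambda1); set z := szego lambda1.
have z1 : inner (word [::]) z = 1 by rewrite inner_szego_word big_nil.
move=> /(disc_algebra_multiplicative z1)[|_ -> //] => i phi.
by rewrite !inner_szego_creation z1 mulr1.
Qed.

Lemma eval_row_creation lambda (lambda1 : ell2_norm lambda < 1) (a : ell2 R I) :
  point_eval (row_creation a) lambda = inner a (ell2_conj lambda).
Proof.
rewrite (point_evalE lambda1); set z := szego lambda1.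
apply/eqP; rewrite -subr_eq0; apply/eqP.
apply: (@functional_eq0 _ _
  (fun a => inner (row_creation a (word [::])) z - inner a (ell2_conj lambda))
  (ell2_norm (word [::] : fock R I) * ell2_norm z + ell2_norm lambda)).
- move=> c x y; rewrite row_creationDl !innerDl !innerZl; ring.
- move=> x; apply: le_trans (le_normcD _ _) _; rewrite normcN mulrDl lerD//.
    apply: le_trans (cauchy_schwarz _ _) _.
    by rewrite row_creation_norm mulrC mulrCA mulrA [_ * ell2_norm x]mulrC mulrA mulrAC.
  apply: le_trans (cauchy_schwarz _ _) _.
  by rewrite ell2_norm_conj mulrC.
- move=> i; rewrite row_creation_delta creation_word inner_szego_word big_seq1.
  by rewrite innerC inner_delta conjCK subrr.
Qed.

(** Splitting off the first letter: the Szego vector is the geometric series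
    (1 - sum_i conj(mu_i) S_i)^-1 1. *)
Lemma szego_row_creation mu (mu1 : ell2_norm mu < 1) :
  szego mu1 = word [::] + row_creation (ell2_conj mu) (szego mu1).
Proof.
apply/val_inj/funext => -[|i beta]; rewrite /= fctE /word_fun/=.
  by rewrite big_nil rmorph1 addr0.
by rewrite big_cons rmorphM add0r.
Qed.

Lemma one_sub_inner_neq0 lambda mu : ell2_norm lambda < 1 -> ell2_norm mu < 1 ->
  1 - inner lambda mu != 0.
Proof.
move=> lambda1 mu1.
rewrite subr_eq0; apply: contraTneq (cauchy_schwarz lambda mu) => <-.
rewrite ComplexField.Normc.normc1 -ltNge.
apply: (@le_lt_trans _ _ (ell2_norm lambda * 1)); last by rewrite mulr1.
by rewrite ler_wpM2l ?ell2_norm_ge0// ltW.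
Qed.

(** Pair the previous equation with szego lambda: multiplicativity gives
    Q = 1 + <lambda, mu> Q for the unknown Q. *)
Lemma szego_kernel lambda mu (lambda1 : ell2_norm lambda < 1) (mu1 : ell2_norm mu < 1) :
  inner (szego mu1) (szego lambda1) = (1 - inner lambda mu)^-1.
Proof.
have le1 := one_sub_inner_neq0 lambda1 mu1.
set Q := inner _ _; suff : Q = 1 + inner lambda mu * Q.
  move=> QE; apply: (mulfI le1); rewrite mulfV// mulrBl mul1r {1}QE; ring.
rewrite {1}/Q szego_row_creation innerDl inner_szego_word big_nil; congr (_ + _).
rewrite disc_algebra_eval; last exact: disc_algebra_row_creation.
by rewrite eval_row_creation// inner_conj.
Qed.

End Szego.

(** * Transfer functions of contractive colligations *)

Section Realization.
Context {R : realType} {I : choiceType} {k : nat}.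

(** The block operator [[a, b], [c, d]] : C^k + C -> (ell2 (x) C^k) + C is a
    contraction. *)
Definition contractive_colligation (a : 'I_k -> 'I_k -> ell2 R I)
    (b : 'I_k -> ell2 R I) (c : 'I_k -> R[i]) (d : R[i]) :=
  forall (v : 'I_k -> R[i]) (s : R[i]),
  \sum_p ell2_norm (\sum_q v q *: a p q + s *: b p) ^+ 2 +
    normc (\sum_q c q * v q + d * s) ^+ 2 <=
  \sum_q normc (v q) ^+ 2 + normc s ^+ 2.

Variables (a : 'I_k -> 'I_k -> ell2 R I) (b : 'I_k -> ell2 R I).
Variables (c : 'I_k -> R[i]) (d : R[i]).
Hypothesis contractive : contractive_colligation a b c d.
Implicit Types (psi : fock R I) (chi : 'I_k -> fock R I).

(** The colligation tensored with the identity of the Fock space is still a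
    contraction: on the left-hand side the row operators at i :: beta, and the second
    term at beta, only involve chi and psi at beta, so the scalar inequality may be
    summed over beta. *)
Lemma colligation_norm chi psi :
  \sum_p ell2_norm (\sum_q row_creation (a p q) (chi q) + row_creation (b p) psi) ^+ 2 +
    ell2_norm (\sum_q c q *: chi q + d *: psi) ^+ 2 <=
  \sum_q ell2_norm (chi q) ^+ 2 + ell2_norm psi ^+ 2.
Proof.
have u0 p : normc ((\sum_q row_creation (a p q) (chi q) +
    row_creation (b p) psi) [::]) ^+ 2 = 0.
  rewrite ell2_addE ell2_sumE big1// [_ + _]addr0.
  by rewrite ComplexField.Normc.normc0 expr0n.
rewrite -lee_fin !EFinD -!sumEFin.
under eq_bigr do rewrite -ell2_sqsum sqsum_words.
under [X in (_ <= X + _)%E]eq_bigr do rewrite -ell2_sqsum.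
rewrite -!ell2_sqsum /sqsum.
rewrite -[X in (_ <= X + _)%E]esum_sum => [|alpha q _ _]; last by rewrite lee_fin sqr_ge0.
rewrite -esumD => [|alpha _|alpha _]; first last.
- by rewrite lee_fin sqr_ge0.
- by apply: sume_ge0 => q _; rewrite lee_fin sqr_ge0.
under eq_bigr do rewrite u0 add0e.
rewrite -esum_sum => [|alpha q _ _]; last by apply: esum_ge0 => i _; rewrite lee_fin sqr_ge0.
rewrite -esumD => [|alpha _|alpha _]; first last.
- by rewrite lee_fin sqr_ge0.
- by apply: sume_ge0 => q _; apply: esum_ge0 => i _; rewrite lee_fin sqr_ge0.
apply: le_esum => beta _.
have := contractive (fun q => chi q beta) (psi beta).
rewrite -lee_fin !EFinD -!sumEFin; congr (_ <= _)%E; congr (_ + _)%E.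
  apply: eq_bigr => p _; rewrite -ell2_sqsum; apply: eq_esum => i _.
  congr (_ ^+ 2)%:E; congr normc.
  rewrite /= !fctE !ell2_sumE; congr (_ + _); last by rewrite /= mulrC.
  by apply: eq_bigr => q _; rewrite /= mulrC.
by rewrite /= !fctE ell2_sumE.
Qed.

Variable rho : R.
Hypothesis rho01 : 0 < rho < 1.

(** Coefficients of h = (1 - rho L_a)^-1 rho L_b psi.  Since h = rho (L_a h + L_b psi)
    expresses the coefficient of h at i :: beta through h and psi at beta, h is
    obtained by recursion on words, without inverting an operator. *)
Fixpoint resolvent_fun (psi : seq I -> R[i]^o) (alpha : seq I) : 'I_k -> R[i]^o :=
  if alpha is i :: beta then
    fun p => rho%:C%C * (\sum_q resolvent_fun psi beta q * a p q i + psi beta * b p i)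
  else fun=> 0.

Lemma resolvent_sqsum psi (A : {fset seq I}) :
  \sum_(alpha <- A) \sum_p normc (resolvent_fun psi alpha p) ^+ 2 <=
  rho ^+ 2 * ell2_norm psi ^+ 2 / (1 - rho ^+ 2).
Proof.
have /andP[rho0 rho1] := rho01.
pose g alpha := \sum_p normc (resolvent_fun psi alpha p) ^+ 2.
have g0 alpha : 0 <= g alpha by apply: sumr_ge0 => p _; exact: sqr_ge0.
have -> : rho ^+ 2 * ell2_norm psi ^+ 2 = g [::] + rho ^+ 2 * ell2_norm psi ^+ 2.
  rewrite /g big1 ?add0r// => p _ /=.
  by rewrite [Num.sqrt _](ComplexField.Normc.normc0 R) expr0n.
move: A; apply: (@sum_words_le _ _ g (fun alpha => normc (psi alpha) ^+ 2)) => //.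
- by rewrite sqr_ge0/= expr_lt1// ltW.
- by move=> alpha; exact: sqr_ge0.
- by move=> A; exact: sqsum_fset.
move=> beta; set v := resolvent_fun psi beta.
pose y p : ell2 R I := rho%:C%C *: (\sum_q v q *: a p q + psi beta *: b p).
apply: (@le_trans _ _ (\sum_p ell2_norm (y p) ^+ 2)%:E).
  rewrite -sumEFin; under eq_bigr do rewrite -ell2_sqsum.
  rewrite -esum_sum => [|i p _ _]; last by rewrite lee_fin sqr_ge0.
  apply: le_esum => i _; rewrite sumEFin lee_fin; apply: ler_sum => p _.
  rewrite le_eqVlt; apply/orP; left; apply/eqP; congr (normc _ ^+ 2).
  rewrite /y [RHS]/(rho%:C%C * ((\sum_q v q *: a p q + psi beta *: b p) i)).
  rewrite ell2_addE ell2_sumE /=; congr (_ * (_ + _)).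
rewrite lee_fin /y; under eq_bigr do rewrite ell2_normZ normc_real exprMn.
rewrite -mulr_sumr real_normK ?num_real// ler_wpM2l ?sqr_ge0//.
apply: le_trans (contractive v (psi beta)).
by rewrite lerDl sqr_ge0.
Qed.

Lemma resolvent_ell2 p psi : resolvent_fun psi ^~ p \in @ell2_pred R (seq I).
Proof.
apply/ell2_predP; exists (rho ^+ 2 * ell2_norm psi ^+ 2 / (1 - rho ^+ 2)).
apply/sqsum_leP => A; apply: le_trans (resolvent_sqsum psi A).
apply: ler_sum => alpha _; rewrite (bigD1 p)//= lerDl.
by apply: sumr_ge0 => q _; exact: sqr_ge0.
Qed.

Definition resolvent p psi : fock R I := Ell2 (resolvent_ell2 p psi).

Lemma resolventE p psi : resolvent p psi = rho%:C%C *: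
  (\sum_q row_creation (a p q) (resolvent q psi) + row_creation (b p) psi).
Proof.
apply: ell2P => -[|i beta]; rewrite ell2_scaleE ell2_addE ell2_sumE.
  by rewrite big1// (_ : row_creation (b p) psi [::] = 0)// addr0 mulr0.
rewrite /= [psi beta * _]mulrC; congr (_ * (_ + _)).
by apply: eq_bigr => q _; rewrite mulrC.
Qed.

Lemma resolvent_linear p : linear (resolvent p).
Proof.
move=> s x y; apply: ell2P => alpha.
rewrite [RHS](_ : _ = s * resolvent p x alpha + resolvent p y alpha)//.
elim: alpha p => [|i beta IHbeta] p.
  by rewrite (_ : forall u, resolvent p u [::] = 0)// mulr0 addr0.
have step u : resolvent p u (i :: beta) =
    rho%:C%C * (\sum_q resolvent q u beta * a p q i + u beta * b p i) by [].
rewrite !step [X in _ + X * _](_ : _ = s * x beta + y beta)//.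
under eq_bigr do rewrite IHbeta mulrDl -mulrA.
by rewrite big_split/= -mulr_sumr mulrDl; ring.
Qed.

(** With h = rho y, y = L_a h + L_b psi and F = c h + d psi, contractivity reads
    |y|^2 + |F|^2 <= |h|^2 + |psi|^2; multiply by rho^2.  The two terms on the left
    give at once |F| <= |psi| and |h|^2 <= rho^2 / (1 - rho^2) |psi|^2. *)
Lemma resolvent_bound psi : (1 - rho ^+ 2) * \sum_p ell2_norm (resolvent p psi) ^+ 2 +
  rho ^+ 2 * ell2_norm (\sum_q c q *: resolvent q psi + d *: psi) ^+ 2 <=
  rho ^+ 2 * ell2_norm psi ^+ 2.
Proof.
have := colligation_norm (resolvent ^~ psi) psi.
set t := \sum_p ell2_norm (resolvent p psi) ^+ 2; set y := \sum_p _.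
set F := ell2_norm _ ^+ 2; set P := ell2_norm psi ^+ 2.
have : t = rho ^+ 2 * y.
  rewrite /y mulr_sumr; apply: eq_bigr => p _.
  by rewrite resolventE ell2_normZ normc_real exprMn real_normK ?num_real.
move=> tE yF; have := ler_wpM2l (sqr_ge0 rho) yF; rewrite mulrDr -tE; lra.
Qed.

(** Partial sums of the Neumann series of the resolvent, by iteration of its fixed
    point equation from 0.  The factor 1 fits finite sums to the form used for
    linear combinations in the disc algebra. *)
Fixpoint neumann (N : nat) (p : 'I_k) : fock R I -> fock R I :=
  if N is M.+1 then
    rho%:C%C *: (\sum_q 1 *: (row_creation (a p q) \o neumann M q) +
                 row_creation (b p))
  else 0.

Lemma disc_algebra_neumann N p : disc_algebra (neumann N p).
Proof.
elim: N p => [|N IHN] p /=; first exact: disc_algebra0.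
apply: disc_algebra_scale; apply: disc_algebra_add.
  apply: disc_algebra_sum => q; apply: disc_algebra_comp => //.
  exact: disc_algebra_row_creation.
exact: disc_algebra_row_creation.
Qed.

(** The error satisfies the homogeneous equation, and L_a is a contraction. *)
Lemma neumann_error N psi :
  \sum_p ell2_norm (resolvent p psi - neumann N p psi) ^+ 2 <=
  (rho ^+ 2) ^+ N * \sum_p ell2_norm (resolvent p psi) ^+ 2.
Proof.
elim: N => [|N IHN]; first by rewrite mul1r; apply: ler_sum => p _; rewrite subr0.
pose chi q := resolvent q psi - neumann N q psi.
have step p : resolvent p psi - neumann N.+1 p psi =
    rho%:C%C *: (\sum_q row_creation (a p q) (chi q) + row_creation (b p) 0).
  rewrite {1}resolventE /= -[X in _ - X]/(rho%:C%C *: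
    ((\sum_q 1 *: (row_creation (a p q) \o neumann N q)) psi + row_creation (b p) psi)).
  rewrite -scalerBr sumfunE; congr (_ *: _).
  rewrite opprD addrACA subrr addr0 (linear_map0 (row_creation_linear _)) addr0.
  rewrite -sumrB; apply: eq_bigr => q _.
  by rewrite /chi (linear_mapB (row_creation_linear _)) fctE scale1r.
rewrite (eq_bigr _ (fun p _ => congr1 (fun x => ell2_norm x ^+ 2) (step p))).
under eq_bigr do rewrite ell2_normZ normc_real exprMn real_normK ?num_real//.
rewrite -mulr_sumr [_ ^+ N.+1]exprS -mulrA ler_wpM2l ?sqr_ge0//.
apply: le_trans IHN; have := colligation_norm chi 0.
by rewrite ell2_norm0 expr0n/= addr0; apply: le_trans; rewrite lerDl sqr_ge0.
Qed.

Lemma resolvent_norm p psi :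
  (1 - rho ^+ 2) * ell2_norm (resolvent p psi) ^+ 2 <= rho ^+ 2 * ell2_norm psi ^+ 2.
Proof.
have /andP[rho0 rho1] := rho01; apply: le_trans (resolvent_bound psi).
rewrite (bigD1 p)//= mulrDr -addrA lerDl addr_ge0// mulr_ge0 ?sqr_ge0//.
  by rewrite subr_ge0 expr_le1// ltW.
by apply: sumr_ge0 => q _; exact: sqr_ge0.
Qed.

Lemma disc_algebra_resolvent p : disc_algebra (resolvent p).
Proof.
have /andP[rho0 rho1] := rho01.
have r1 : 0 < 1 - rho by rewrite subr_gt0.
have r2 : 0 < 1 - rho ^+ 2 by rewrite subr_gt0 expr_lt1// ltW.
have total psi : \sum_p ell2_norm (resolvent p psi) ^+ 2 <=
    (ell2_norm psi / (1 - rho)) ^+ 2.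
  rewrite exprMn exprVn ler_pdivlMr ?exprn_gt0//.
  rewrite -(ler_pM2l r2); apply: (@le_trans _ _
    ((1 - rho) ^+ 2 * (rho ^+ 2 * ell2_norm psi ^+ 2))).
    rewrite mulrA mulrC ler_wpM2l ?sqr_ge0//.
    apply: le_trans (resolvent_bound psi); rewrite lerDl.
    by rewrite mulr_ge0 ?sqr_ge0.
  rewrite mulrA ler_wpM2r ?sqr_ge0//; nra.
apply: disc_algebra_lim => [|e e0].
  apply/bounded_operatorP; split; first exact: resolvent_linear.
  exists (1 - rho)^-1 => [|psi]; first by rewrite invr_ge0 ltW.
  rewrite -ler_sqr ?nnegrE ?ell2_norm_ge0//; last first.
    by rewrite mulr_ge0 ?ell2_norm_ge0// invr_ge0 ltW.
  rewrite [_^-1 * _]mulrC; apply: le_trans (total psi).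
  rewrite (bigD1 p)//= lerDl.
  by apply: sumr_ge0 => q _; exact: sqr_ge0.
have [N rhoN] : exists N, rho ^+ N <= e * (1 - rho).
  have /cvgrPdist_le/(_ _ (mulr_gt0 e0 r1)) : (rho ^+ n @[n --> \oo] --> 0)%classic.
    by apply: cvg_expr; rewrite ger0_norm// ltW.
  move=> [N _ NP]; have := NP N (@ssrnat.leqnn N); rewrite /= sub0r normrN.
  by rewrite ger0_norm ?exprn_ge0 ?(ltW rho0)// => rhoN; exists N.
exists (neumann N p) => [|psi]; first exact: disc_algebra_neumann.
rewrite -ler_sqr ?nnegrE ?ell2_norm_ge0 ?mulr_ge0 ?ell2_norm_ge0 ?(ltW e0)//.
apply: (@le_trans _ _ (\sum_p ell2_norm (resolvent p psi - neumann N p psi) ^+ 2)).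
  rewrite (bigD1 p)//= lerDl.
  by apply: sumr_ge0 => q _; exact: sqr_ge0.
apply: le_trans (neumann_error N psi) _.
rewrite -exprM mulnC exprM.
apply: (@le_trans _ _ ((rho ^+ N) ^+ 2 * (ell2_norm psi / (1 - rho)) ^+ 2)).
  by rewrite ler_wpM2l ?sqr_ge0.
rewrite -exprMn ler_sqr ?nnegrE ?mulr_ge0 ?ell2_norm_ge0 ?invr_ge0 ?exprn_ge0
  ?(ltW e0) ?(ltW r1) ?(ltW rho0)//.
by rewrite mulrCA mulrC ler_wpM2r ?ell2_norm_ge0// ler_pdivrMr.
Qed.

(** The transfer function d + c (1 - rho L_a)^-1 rho L_b. *)
Definition transfer : fock R I -> fock R I :=
  \sum_q c q *: resolvent q + d *: idfun.

Lemma transferE psi : transfer psi = \sum_q c q *: resolvent q psi + d *: psi.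
Proof. by rewrite /transfer fctE sumfunE. Qed.

Lemma disc_algebra_transfer : disc_algebra transfer.
Proof.
apply: disc_algebra_add; last by apply: disc_algebra_scale; exact: disc_algebra_id.
by apply: disc_algebra_sum => q; exact: disc_algebra_resolvent.
Qed.

Lemma transfer_norm psi : ell2_norm (transfer psi) <= ell2_norm psi.
Proof.
have /andP[rho0 rho1] := rho01.
rewrite -ler_sqr ?nnegrE ?ell2_norm_ge0//.
rewrite -(@ler_pM2l _ (rho ^+ 2)) ?exprn_gt0// transferE.
apply: le_trans (resolvent_bound psi); rewrite lerDr mulr_ge0//.
  by rewrite subr_ge0 expr_le1// ltW.
by apply: sumr_ge0 => q _; exact: sqr_ge0.
Qed.

(** Evaluate h = rho (L_a h + L_b 1) at lambda, pair with B and use that the transposed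
    colligation sends (lambda (x) B, 1) to (B, w).  At rho = 1 the conclusion
    would be f(lambda) = w. *)
Lemma transfer_eval (lambda : ell2 R I) (lambda1 : ell2_norm lambda < 1)
    (B : 'I_k -> R[i]) (w : R[i]) :
  (forall q, \sum_p B p * inner (a p q) (ell2_conj lambda) + c q = B q) ->
  \sum_p B p * inner (b p) (ell2_conj lambda) + d = w ->
  rho%:C%C * (w - point_eval transfer lambda) =
  (1 - rho)%:C%C * \sum_p B p * point_eval (resolvent p) lambda.
Proof.
move=> Ba Bb; set z := szego lambda1.
pose eta p := point_eval (resolvent p) lambda.
have z1 : inner (word [::]) z = 1 by rewrite inner_szego_word big_nil.
have etaE p : eta p = rho%:C%C * (\sum_q inner (a p q) (ell2_conj lambda) * eta q +
    inner (b p) (ell2_conj lambda)).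
  rewrite {1}/eta (point_evalE lambda1) resolventE innerZl innerDl inner_suml.
  congr (_ * (_ + _)); last by rewrite -(eval_row_creation lambda1) (point_evalE lambda1).
  apply: eq_bigr => q _; rewrite disc_algebra_eval; last exact: disc_algebra_row_creation.
  by rewrite eval_row_creation// -(point_evalE lambda1).
have -> : point_eval transfer lambda = \sum_q c q * eta q + d.
  rewrite (point_evalE lambda1) transferE innerDl inner_suml innerZl z1 mulr1.
  congr (_ + _); apply: eq_bigr => q _.
  by rewrite innerZl -(point_evalE lambda1).
have : \sum_p B p * eta p = rho%:C%C * (\sum_q (B q - c q) * eta q + (w - d)).
  rewrite -{1}Bb addrK.
  transitivity (rho%:C%C * (\sum_p \sum_q B p * inner (a p q) (ell2_conj lambda) * eta q +
    \sum_p B p * inner (b p) (ell2_conj lambda))).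
    rewrite -big_split/= mulr_sumr; apply: eq_bigr => p _.
    rewrite {1}etaE mulrCA; congr (_ * _); rewrite mulrDr mulr_sumr; congr (_ + _).
    by apply: eq_bigr => q _; rewrite mulrA.
  rewrite exchange_big/=; congr (_ * (_ + _)); apply: eq_bigr => q _.
  by rewrite -mulr_suml -{1}(Ba q) addrK.
have -> : \sum_q (B q - c q) * eta q = \sum_q B q * eta q - \sum_q c q * eta q.
  by rewrite -sumrB; apply: eq_bigr => q _; rewrite mulrBl.
rewrite rmorphB rmorph1/= -/eta; set S := \sum_q B q * eta q => SE.
by rewrite mulrBl mul1r {1}SE; ring.
Qed.

(** The resolvent may blow up as rho tends to 1, but resolvent_norm bounds it by
    rho / sigma, whereas the defect carries the factor 1 - rho = sigma^2. *)
Lemma transfer_defect (lambda : ell2 R I) (lambda1 : ell2_norm lambda < 1)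
    (B : 'I_k -> R[i]) (w : R[i]) (sigma : R) : 0 < sigma -> rho = 1 - sigma ^+ 2 ->
  (forall q, \sum_p B p * inner (a p q) (ell2_conj lambda) + c q = B q) ->
  \sum_p B p * inner (b p) (ell2_conj lambda) + d = w ->
  normc (w - point_eval transfer lambda) <=
  sigma * (\sum_p normc (B p) * ell2_norm (szego lambda1)).
Proof.
move=> sigma0 rhoE Ba Bb; have /andP[rho0 rho1] := rho01.
have word1 : ell2_norm (word [::] : fock R I) = 1.
  have := inner_norm (word [::] : fock R I).
  rewrite wordE inner_delta [X in X = _](_ : _ = 1%:C%C)// => /complexI/esym/eqP.
  rewrite sqrf_eq1 => /orP[/eqP //|/eqP N1].
  by have := ell2_norm_ge0 (delta [::] : fock R I); rewrite N1 ler0N1.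
have res p : sigma * ell2_norm (resolvent p (word [::])) <= rho.
  rewrite -ler_sqr ?nnegrE ?mulr_ge0 ?ell2_norm_ge0 ?(ltW sigma0) ?(ltW rho0)//.
  have := resolvent_norm p (word [::]); rewrite word1 expr1n mulr1.
  apply: le_trans; rewrite exprMn ler_wpM2r ?sqr_ge0//.
  have -> : sigma ^+ 2 = 1 - rho by rewrite rhoE; ring.
  by nra.
have := congr1 (@normc R) (transfer_eval lambda1 Ba Bb).
rewrite !ComplexField.Normc.normcM !normc_real (gtr0_norm rho0).
rewrite gtr0_norm ?subr_gt0// => E.
rewrite -(ler_pM2l rho0) E; have -> : 1 - rho = sigma * sigma by rewrite rhoE; ring.
rewrite -mulrA [leRHS]mulrCA ler_wpM2l ?(ltW sigma0)//.
apply: (@le_trans _ _ (sigma * \sum_p normc (B p * point_eval (resolvent p) lambda))).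
  rewrite ler_wpM2l ?(ltW sigma0)//.
  elim/big_rec2 : _ => [|p x y _ xy]; first by rewrite ComplexField.Normc.normc0.
  by apply: le_trans (le_normcD _ _) _; rewrite lerD2l.
rewrite !mulr_sumr; apply: ler_sum => p _.
rewrite ComplexField.Normc.normcM (point_evalE lambda1) mulrCA [leRHS]mulrCA.
rewrite ler_wpM2l ?normc_ge0//.
apply: (@le_trans _ _ (sigma * (ell2_norm (resolvent p (word [::])) *
   ell2_norm (szego lambda1)))).
  by rewrite ler_wpM2l ?(ltW sigma0)// cauchy_schwarz.
by rewrite mulrA ler_wpM2r ?ell2_norm_ge0.
Qed.

End Realization.

Section ApproximateInterpolation.
Context {R : realType} {I : choiceType} {k : nat}.

Lemma approximate_interpolation (n : nat) (lambda : 'I_n -> ell2 R I) (w : 'I_n -> R[i])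
    (a : 'I_k -> 'I_k -> ell2 R I) (b : 'I_k -> ell2 R I) (c : 'I_k -> R[i]) (d : R[i])
    (B : 'I_n -> 'I_k -> R[i]) :
  (forall i, ell2_norm (lambda i) < 1) ->
  contractive_colligation a b c d ->
  (forall i q, \sum_p B i p * inner (a p q) (ell2_conj (lambda i)) + c q = B i q) ->
  (forall i, \sum_p B i p * inner (b p) (ell2_conj (lambda i)) + d = w i) ->
  forall e : R, 0 < e -> exists f : fock R I -> fock R I,
    [/\ disc_algebra f, forall psi, ell2_norm (f psi) <= ell2_norm psi &
        forall i, normc (w i - point_eval f (lambda i)) <= e].
Proof.
move=> lambda1 ctr Ba Bb e e0.
pose M := \sum_i \sum_p normc (B i p) * ell2_norm (szego (lambda1 i)).
have M0 i : 0 <= \sum_p normc (B i p) * ell2_norm (szego (lambda1 i)).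
  by apply: sumr_ge0 => p _; rewrite mulr_ge0 ?normc_ge0 ?ell2_norm_ge0.
have MM : 0 <= M by apply: sumr_ge0.
(* Makes both sigma < 1 and sigma M <= e. *)
pose sigma := e / (1 + e + M).
have D0 : 0 < 1 + e + M by rewrite ltr_pwDl// ltr_pwDl// ltW.
have sigma0 : 0 < sigma by rewrite divr_gt0.
have sigma1 : sigma < 1 by rewrite ltr_pdivrMr// mul1r -addrA addrCA ltrDl ltr_pwDl.
have rho01 : 0 < 1 - sigma ^+ 2 < 1.
  by rewrite subr_gt0 expr_lt1 ?(ltW sigma0)// sigma1 gtrBl exprn_gt0.
exists (transfer ctr rho01); split.
- exact: disc_algebra_transfer.
- exact: transfer_norm.
- move=> i; apply: le_trans
    (transfer_defect ctr rho01 (lambda1 i) sigma0 erefl (Ba i) (Bb i)) _.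
  rewrite /sigma mulrAC ler_pdivrMr// ler_wpM2l ?(ltW e0)//.
  rewrite ler_wpDl ?addr_ge0 ?(ltW e0)// /M (bigD1 i)//= lerDl.
  by apply: sumr_ge0.
Qed.

End ApproximateInterpolation.

(** * Factorization and projection of complex matrices *)

Section LinearAlgebra.
Local Open Scope sesquilinear_scope.
Context {R : realType}.
Local Notation C := R[i].

Lemma trmxC_mul m n p (A : 'M[C]_(m, n)) (B : 'M[C]_(n, p)) :
  (A *m B)^t* = B^t* *m A^t*.
Proof. by rewrite trmx_mul map_mxM. Qed.

Lemma psd_factor n (A : 'M[C]_n) : A^t* = A -> posdefmx A ->
  exists B : 'M[C]_n, A = B^t* *m B.
Proof.
move=> AH Apos; have /orthomx_spectralP : A \is normalmx by apply/normalmxP; rewrite AH.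
set P := spectralmx A; set D := spectral_diag A; move=> AE.
have Pu : P \is unitarymx := spectral_unitarymx A.
rewrite invmx_unitary// in AE.
have PAP : P *m A *m P^t* = diag_mx D.
  rewrite AE !mulmxA (unitarymxP Pu) mul1mx -mulmxA (unitarymxP Pu).
  by rewrite mulmx1.
have D0 i : 0 <= D 0 i.
  have := Apos (P^t* *m delta_mx i 0); rewrite trmxC_mul trmxCK.
  rewrite -!mulmxA [A *m _]mulmxA [P *m _]mulmxA [P *m _]mulmxA PAP.
  rewrite trmx_delta map_delta_mx mul_diag_mx -rowE !mxE.
  by rewrite !eqxx mulr1.
pose S : 'rV[C]_n := \row_i sqrtC (D 0 i).
exists (diag_mx S *m P); rewrite trmxC_mul {1}AE -!mulmxA; congr (_ *m _).
rewrite mulmxA; congr (_ *m _); rewrite tr_diag_mx map_diag_mx.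
rewrite mul_diag_mx; apply/matrixP => i j; rewrite !mxE.
rewrite mulrnAr; congr (_ *+ _).
have s0 : 0 <= sqrtC (D 0 i) by rewrite sqrtC_ge0.
by rewrite /= (geC0_conj s0) -expr2 sqrtCK.
Qed.

(** P = M Y^* is the orthogonal projection onto the column space of Y, given together
    with a factorization through Y^*: M plays the role of Y (Y^* Y)^-1 also when the
    Gram matrix Y^* Y is singular. *)
Lemma orthogonal_projection n k (Y : 'M[C]_(n, k)) : exists M : 'M[C]_(n, k),
  [/\ M *m Y^t* *m Y = Y, (M *m Y^t*)^t* = M *m Y^t* &
      M *m Y^t* *m (M *m Y^t*) = M *m Y^t*].
Proof.
pose P := proj_ortho (Y^t*).
have /submxP[M PE] : (P <= Y^t*)%MS by rewrite -[P]mul1mx proj_ortho_sub.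
exists M; rewrite -PE.
have PY : P *m Y = Y.
  have : (1%:M - 1%:M *m P) *m (Y^t*)^t* = 0.
    by apply/eqP; rewrite -orthomx1E; exact: proj_ortho_compl_sub.
  by rewrite trmxCK mul1mx mulmxBl mul1mx => /eqP; rewrite subr_eq0 => /eqP.
clearbody P.
have PP : P *m P^t* = P^t* by rewrite {2 3}PE trmxC_mul trmxCK mulmxA PY.
have PH : P^t* = P by rewrite -[RHS]trmxCK -[in RHS]PP trmxC_mul trmxCK PP.
by split=> //; rewrite -{2}PH PP.
Qed.

Lemma row_norm n (x : 'rV[C]_n) :
  (x *m x^t*) 0 0 = (\sum_j normc (x 0 j) ^+ 2)%:C%C.
Proof.
rewrite !mxE rmorph_sum; apply: eq_bigr => j _.
by rewrite !mxE mulJ.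
Qed.

Lemma row_projection_le n (P : 'M[C]_n) (x : 'rV[C]_n) : P^t* = P -> P *m P = P ->
  (x *m P *m x^t*) 0 0 <= (x *m x^t*) 0 0.
Proof.
move=> PH PP; rewrite -subr_ge0.
have -> : (x *m x^t*) 0 0 - (x *m P *m x^t*) 0 0 =
    ((x - x *m P) *m (x - x *m P)^t*) 0 0.
  rewrite linearB/= map_mxB trmxC_mul PH mulmxBl !mulmxBr !mulmxA.
  by rewrite -[x *m P *m P]mulmxA PP [x *m P *m _ - _]subrr subr0 !mxE.
by rewrite row_norm ler0c; apply: sumr_ge0 => j _; exact: sqr_ge0.
Qed.

End LinearAlgebra.

(** * From a positive Pick matrix to a colligation *)

Section PickColligation.
Local Open Scope sesquilinear_scope.
Context {R : realType} {I : choiceType} {k : nat}.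
Local Notation C := R[i].
Variables (lambda : 'I_k -> ell2 R I) (w : 'I_k -> C).
Hypothesis lambda1 : forall i, ell2_norm (lambda i) < 1.

Definition pick_matrix : 'M[C]_k := \matrix_(i < k, j < k)
  ((1 - w j * (w i)^*) / (1 - inner (lambda j) (lambda i))).

Lemma pick_matrix_herm : pick_matrix^t* = pick_matrix.
Proof.
apply/matrixP => i j; rewrite !mxE.
by rewrite fmorph_div/= !rmorphB/= rmorphM/= rmorph1 conjCK -innerC [w j * _]mulrC.
Qed.

(** Let y_i = (b_i, w_i) be the columns of Y, and G = Y^* Y.  By the definition of the
    Pick matrix, G is also the Gram matrix of x_i = (lambda_i (x) b_i, 1).  With
    P = M Y^* the projection onto the column space of Y, the contraction maps a
    row y of coefficients to sum_j (y M)_j conj(x_j).  Pairing with x_i uses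
    M G = Y, and the squared norm of the image of y is y M G M^* y^* = y P y^*. *)
Lemma pick_colligation : posdefmx pick_matrix ->
  exists (a : 'I_k -> 'I_k -> ell2 R I) (b : 'I_k -> ell2 R I) (c : 'I_k -> C) (d : C)
    (B : 'I_k -> 'I_k -> C),
  [/\ contractive_colligation a b c d,
      forall i q, \sum_p B i p * inner (a p q) (ell2_conj (lambda i)) + c q = B i q &
      forall i, \sum_p B i p * inner (b p) (ell2_conj (lambda i)) + d = w i].
Proof.
move=> /(psd_factor pick_matrix_herm)[B BE].
pose Y : 'M[C]_(k + 1, k) := col_mx B (\row_i w i).
have [M [MY PH PP]] := orthogonal_projection Y.
pose X i j := inner (lambda i) (lambda j).
pose G := Y^t* *m Y.
have BBE j i : \sum_p (B p j)^* * B p i = (1 - w i * (w j)^*) / (1 - X i j).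
  move/matrixP: BE => /(_ j i); rewrite !mxE => ->.
  by apply: eq_bigr => p _; rewrite !mxE.
(* Both Gram matrices: 1 + N_ji <lambda_i, lambda_j> = N_ji + conj(w_j) w_i, where N
   is the Pick matrix. *)
have GE j i : G j i = (\sum_p (B p j)^* * B p i) * X i j + 1.
  rewrite mxE big_split_ord/= big_ord1.
  under eq_bigr do rewrite !mxE !(unsplitK (inl _)) /=.
  rewrite !mxE !(unsplitK (inr _)) /= !mxE BBE.
  field; exact: one_sub_inner_neq0.
pose l j := ell2_conj (lambda j).
pose M1 := usubmx M; pose m := dsubmx M.
exists (fun p q => \sum_j (M1 q j * (B p j)^*) *: l j).
exists (fun p => \sum_j (m 0 j * (B p j)^*) *: l j).
exists (fun q => \sum_j M1 q j), (\sum_j m 0 j), (fun i p => B p i).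
have eval (N : 'rV[C]_k) i : \sum_p B p i *
    inner (\sum_j (N 0 j * (B p j)^*) *: l j) (l i) + \sum_j N 0 j = (N *m G) 0 i.
  under eq_bigr do rewrite inner_suml mulr_sumr.
  rewrite exchange_big/= -big_split/= [RHS]mxE; apply: eq_bigr => j _.
  rewrite GE mulrDr mulr1; congr (_ + _); rewrite mulr_suml mulr_sumr.
  by apply: eq_bigr => p _; rewrite innerZl inner_conj -/(X i j); ring.
have MG : M *m G = Y by rewrite mulmxA.
split=> [v s|i q|i]; last 2 first.
- have rowE j : row q M1 0 j = M1 q j by rewrite mxE.
  have := eval (row q M1) i; rewrite -row_mul mul_usub_mx MG col_mxKu [row _ _ _ _]mxE.
  move=> <-; congr (_ + _); last by apply: eq_bigr => j _; rewrite rowE.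
  apply: eq_bigr => p _; congr (_ * _); rewrite !inner_suml.
  by apply: eq_bigr => j _; rewrite rowE.
- by rewrite eval mul_dsub_mx MG col_mxKd mxE.
pose y : 'rV[C]_(k + 1) := row_mx (\row_q v q) s%:M.
have [gam gamM] : exists gam, gam = y *m M by exists (y *m M).
have gamE j : gam 0 j = \sum_q v q * M1 q j + s * m 0 j.
  rewrite gamM /y -[M]vsubmxK mul_row_col mxE; congr (_ + _); rewrite mxE.
    by apply: eq_bigr => q _; rewrite mxE.
  by rewrite big_ord1 mxE eqxx mulr1n.
have comb p : \sum_q v q *: \sum_j (M1 q j * (B p j)^*) *: l j +
    s *: \sum_j (m 0 j * (B p j)^*) *: l j = \sum_j (gam 0 j * (B p j)^*) *: l j.
  under eq_bigr do rewrite scaler_sumr.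
  rewrite exchange_big/= scaler_sumr -big_split/=; apply: eq_bigr => j _.
  rewrite gamE mulrDl scalerDl mulr_suml scaler_suml; congr (_ + _).
    by apply: eq_bigr => q _; rewrite scalerA mulrA.
  by rewrite scalerA mulrA.
have combs : \sum_q (\sum_j M1 q j) * v q + (\sum_j m 0 j) * s = \sum_j gam 0 j.
  under eq_bigr do rewrite mulr_suml.
  rewrite exchange_big/= mulr_suml -big_split/=; apply: eq_bigr => j _.
  rewrite gamE [s * _]mulrC; congr (_ + _).
  by apply: eq_bigr => q _; rewrite mulrC.
under eq_bigr do rewrite comb; rewrite combs.
rewrite -lecR.
have -> : (\sum_p ell2_norm (\sum_j (gam 0 j * (B p j)^*) *: l j) ^+ 2 +
    normc (\sum_j gam 0 j) ^+ 2)%:C%C = (gam *m G *m gam^t*) 0 0.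
  rewrite rmorphD rmorph_sum/= -mulJ.
  under eq_bigr do rewrite -inner_norm inner_suml.
  rewrite exchange_big/= mulr_suml -big_split/= -mulmxA mxE; apply: eq_bigr => j _.
  rewrite rmorph_sum mulr_sumr.
  under [X in X + _]eq_bigr do rewrite inner_sumr.
  rewrite exchange_big/= -big_split/= [(_ *m _) j 0]mxE mulr_sumr.
  apply: eq_bigr => i _.
  rewrite GE !mxE mulrDl mul1r mulrDr; congr (_ + _).
  rewrite !mulr_suml mulr_sumr; apply: eq_bigr => p _.
  rewrite /l innerZl innerZr inner_conj -/(X i j) rmorphM/= conjCK; ring.
have -> : gam *m G *m gam^t* = y *m (M *m Y^t*) *m y^t*.
  rewrite -[in RHS]PP -{2}PH gamM /G !trmxC_mul trmxCK !mulmxA.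
  by [].
apply: le_trans (row_projection_le y PH PP) _.
rewrite row_norm lecR big_split_ord/= big_ord1 le_eqVlt; apply/orP; left; apply/eqP.
rewrite /y row_mxEr mxE eqxx mulr1n; congr (_ + _).
by apply: eq_bigr => q _; rewrite row_mxEl mxE.
Qed.

End PickColligation.

(** * Exact interpolation *)

Section Evaluation.
Context {R : realType} {I : choiceType}.
Implicit Types (T U : fock R I -> fock R I).

Variables (lambda : ell2 R I) (lambda1 : ell2_norm lambda < 1).

Lemma eval_lin (a : R[i]) T U :
  point_eval (a *: T + U) lambda = a * point_eval T lambda + point_eval U lambda.
Proof. by rewrite !(point_evalE lambda1) !fctE innerDl innerZl. Qed.

Lemma eval_id : point_eval (idfun : fock R I -> fock R I) lambda = 1.
Proof. by rewrite (point_evalE lambda1) inner_szego_word big_nil. Qed.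

Lemma eval_creation i : point_eval (@creation R I i) lambda = lambda i.
Proof. by rewrite (point_evalE lambda1) creation_word inner_szego_word big_seq1. Qed.

Lemma eval_comp T U : disc_algebra T ->
  point_eval (T \o U) lambda = point_eval T lambda * point_eval U lambda.
Proof.
by move=> dT; rewrite [LHS](point_evalE lambda1) /= disc_algebra_eval// -point_evalE.
Qed.

Lemma eval_sum (J : Type) (r : seq J) (c : J -> R[i]) (T : J -> fock R I -> fock R I) :
  point_eval (\sum_(j <- r) c j *: T j) lambda =
  \sum_(j <- r) c j * point_eval (T j) lambda.
Proof.
elim: r => [|j r IHr]; last by rewrite !big_cons eval_lin IHr.
by rewrite !big_nil (point_evalE lambda1) inner0l.
Qed.

End Evaluation.

Section Pick.
Context {R : realType} {I : choiceType} {k : nat}.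
Variables (lambda : 'I_k -> ell2 R I) (w : 'I_k -> R[i]).
Hypothesis lambda1 : forall i, ell2_norm (lambda i) < 1.

(** Multiply, over the points lambda_i different from lambda_j, operators of the form
    (S_m - lambda_i m) / (lambda_j m - lambda_i m), where m is a coordinate
    in which the two points differ. *)
Lemma separating_operator j : exists2 p : fock R I -> fock R I, disc_algebra p &
  forall i, point_eval p (lambda i) = (lambda i == lambda j)%:R.
Proof.
suff [p dp [pj p0]] : exists2 p : fock R I -> fock R I, disc_algebra p &
    point_eval p (lambda j) = 1 /\ forall i, i \in enum 'I_k ->
      lambda i != lambda j -> point_eval p (lambda i) = 0.
  exists p => // i; have [->//|ij] := eqVneq; by rewrite p0// mem_enum.
elim: (enum _) => [|i s [p dp [pj p0]]].
  by exists idfun; [exact: disc_algebra_id|split => //; exact: eval_id].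
have [ij|ij] := eqVneq (lambda i) (lambda j).
  exists p => //; split => // l; rewrite inE => /orP[/eqP->|/p0 //].
  by rewrite ij eqxx.
have [m lm] : exists m, lambda i m != lambda j m.
  apply: contrapT => h; move/eqP: ij; apply; apply: ell2P => m.
  by apply/eqP; apply: contrapT => /negP hm; apply: h; exists m.
have lm0 : lambda j m - lambda i m != 0 by rewrite subr_eq0 eq_sym.
pose q : fock R I -> fock R I :=
  (lambda j m - lambda i m)^-1 *: creation m +
  (- ((lambda j m - lambda i m)^-1 * lambda i m) *: idfun + 0).
have dq : disc_algebra q.
  apply: disc_algebra_lin; first exact: disc_algebra_creation.
  by apply: disc_algebra_lin; [exact: disc_algebra_id|exact: disc_algebra0].
have qE l : point_eval q (lambda l) =
    (lambda j m - lambda i m)^-1 * (lambda l m - lambda i m).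
  rewrite !eval_lin// eval_creation// eval_id//.
  rewrite (_ : point_eval 0 _ = 0) ?(point_evalE (lambda1 l)) ?inner0l//; ring.
exists (q \o p); first exact: disc_algebra_comp.
split=> [|l]; first by rewrite eval_comp// qE pj mulVf ?mulr1.
rewrite inE eval_comp// => /orP[/eqP->|ls lj]; first by rewrite qE subrr mulr0 mul0r.
by rewrite (p0 l)// mulr0.
Qed.

(** Add to an approximate interpolant the separating operators weighted by the
    defects.  A point that occurs several times in the list receives one
    contribution per occurrence, hence the division by its multiplicity. *)
Lemma interpolation_correction :
  (forall i j, lambda i = lambda j -> w i = w j) ->
  (forall e : R, 0 < e -> exists f : fock R I -> fock R I,
    [/\ disc_algebra f, forall psi, ell2_norm (f psi) <= ell2_norm psi &
        forall i, normc (w i - point_eval f (lambda i)) <= e]) ->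
  forall e : R, 0 < e -> exists f : fock R I -> fock R I,
    [/\ disc_algebra f, forall psi, ell2_norm (f psi) <= (1 + e) * ell2_norm psi &
        forall i, point_eval f (lambda i) = w i].
Proof.
move=> w_lambda approx e e0.
have /choice[p pP] : forall j, exists p : fock R I -> fock R I, disc_algebra p /\
    forall i, point_eval p (lambda i) = (lambda i == lambda j)%:R.
  by move=> j; have [p dp pE] := separating_operator j; exists p.
have /choice[C CP] : forall j, exists c, 0 <= c /\
    forall psi, ell2_norm (p j psi) <= c * ell2_norm psi.
  move=> j; have /bounded_operatorP[_ [c c0 cP]] := disc_algebra_bounded (pP j).1.
  by exists c.
pose K := \sum_j C j.
have K0 : 0 < 1 + K by rewrite ltr_pwDl// sumr_ge0// => j _; exact: (CP j).1.
have [f0 [df0 f0_le f0E]] := approx _ (divr_gt0 e0 K0).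
pose mult j : R := #|[pred i | lambda i == lambda j]|%:R.
have mult_ge1 j : 1 <= mult j.
  by rewrite ler1n; apply/card_gt0P; exists j; rewrite inE/=.
have mult_gt0 j : 0 < mult j by apply: lt_le_trans (mult_ge1 j).
pose defect j := w j - point_eval f0 (lambda j).
exists (\sum_j (defect j / (mult j)%:C%C) *: p j + f0); split.
- apply: disc_algebra_add => //; apply: disc_algebra_sum => j; exact: (pP j).1.
- move=> psi; rewrite fctE sumfunE; apply: le_trans (ell2_normD _ _) _.
  rewrite addrC mulrDl mul1r lerD// (le_trans (ell2_norm_sum _ _))//.
  apply: (@le_trans _ _ (\sum_j e / (1 + K) * (C j * ell2_norm psi))).
    apply: ler_sum => j _; rewrite fctE ell2_normZ ler_pM ?normc_ge0 ?ell2_norm_ge0//.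
      rewrite ComplexField.Normc.normcM ComplexField.Normc.normcV normc_real.
      rewrite gtr0_norm// -[leRHS]mulr1.
      rewrite ler_pM ?normc_ge0 ?invr_ge0 ?(ltW (mult_gt0 j))//; first exact: f0E.
      by rewrite invf_le1.
    exact: (CP j).2.
  rewrite -mulr_sumr -mulr_suml mulrA ler_wpM2r ?ell2_norm_ge0//.
  by rewrite mulrAC ler_pdivrMr// ler_wpM2l ?(ltW e0)// lerDr.
- move=> i; rewrite -[X in X + f0]scale1r eval_lin// mul1r eval_sum//.
  under eq_bigr do rewrite (pP _).2.
  rewrite (bigID (mem [pred j | lambda j == lambda i]))/=.
  rewrite [X in _ + X + _]big1 ?addr0 => [|j]; last first.
    by rewrite !inE/= eq_sym => /negPf->; rewrite mulr0.
  rewrite (eq_bigr (fun=> defect i / (mult i)%:C%C)); last first.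
    move=> j jP; have ji : lambda j = lambda i by apply/eqP; move: jP; rewrite inE.
    rewrite ji eqxx mulr1 /defect /mult ji.
    by rewrite (w_lambda _ _ ji).
  rewrite sumr_const -mulr_natr -(rmorph_nat (real_complex R)).
  rewrite -/(mult i) divfK ?subrK// -(rmorph0 (real_complex R)).
  by rewrite (inj_eq (@complexI R)) gt_eqF.
Qed.

(** An interpolating f satisfies f^* u = u' for u = sum_j conj(v_j) z_j and
    u' = sum_j conj(v_j w_j) z_j, so |u'|^2 = <f u', u>, and Cauchy-Schwarz bounds
    |u'| by |f| |u|. *)
Lemma posdef_pick_matrix :
  (forall e : R, 0 < e -> exists f : fock R I -> fock R I,
    [/\ disc_algebra f, (opnorm f <= (1 + e)%:E)%E &
        forall j, point_eval f (lambda j) = w j]) ->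
  posdefmx (pick_matrix lambda w).
Proof.
move=> interp v; pose z j := szego (lambda1 j).
pose comb (c : 'I_k -> R[i]) := \sum_j (c j)^* *: z j.
have inner_comb psi c : inner psi (comb c) = \sum_j c j * inner psi (z j).
  by rewrite inner_sumr; apply: eq_bigr => j _; rewrite innerZr conjCK.
have gram c : (ell2_norm (comb c) ^+ 2)%:C%C =
    \sum_i \sum_j (c i)^* * c j / (1 - inner (lambda j) (lambda i)).
  rewrite -inner_norm {1}/comb inner_suml; apply: eq_bigr => i _.
  rewrite innerZl inner_comb mulr_sumr; apply: eq_bigr => j _.
  by rewrite szego_kernel mulrA.
pose u := comb (fun j => v j 0); pose u' := comb (fun j => v j 0 * w j).
have -> : (map_mx Num.conj v^T *m pick_matrix lambda w *m v) 0 0 =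
    (ell2_norm u ^+ 2 - ell2_norm u' ^+ 2)%:C%C.
  rewrite rmorphB/= !gram -sumrB -mulmxA mxE; apply: eq_bigr => i _.
  rewrite !mxE mulr_sumr -sumrB; apply: eq_bigr => j _.
  by rewrite !mxE rmorphM/=; ring.
rewrite ler0c subr_ge0 ler_sqr ?nnegrE ?ell2_norm_ge0//.
have [->|u'0] := eqVneq (ell2_norm u') 0; first exact: ell2_norm_ge0.
have u'_gt0 : 0 < ell2_norm u' by rewrite lt_neqAle eq_sym u'0 ell2_norm_ge0.
suff le_e e : 0 < e -> ell2_norm u' <= (1 + e) * ell2_norm u.
  apply/ler_addgt0Pr => e e0.
  have D0 : 0 < 1 + ell2_norm u by rewrite ltr_pwDl ?ell2_norm_ge0.
  apply: le_trans (le_e _ (divr_gt0 e0 D0)) _.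
  rewrite mulrDl mul1r lerD2l mulrAC ler_pdivrMr// ler_wpM2l ?(ltW e0)//.
  by rewrite lerDr.
move=> e0; have [f [df fe fE]] := interp e e0.
have [fL _] := disc_algebra_bounded df.
have e1 : 0 <= 1 + e by rewrite addr_ge0// ltW.
have f_le := (opnorm_leP fL e1).1 fe.
have : inner (f u') u = (ell2_norm u' ^+ 2)%:C%C.
  rewrite -inner_norm [in RHS]/u' !inner_comb; apply: eq_bigr => j _.
  by rewrite disc_algebra_eval// fE mulrA.
move=> /(congr1 (@normc R)); rewrite normc_real ger0_norm ?sqr_ge0// => E.
rewrite -(ler_pM2r u'_gt0) -expr2 -E; apply: le_trans (cauchy_schwarz _ _) _.
by rewrite mulrAC ler_wpM2r ?ell2_norm_ge0.
Qed.

(** Repeated points need equal targets: both targets are limits of values of the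
    same operators at the same point. *)
Lemma interpolant_of_posdef : posdefmx (pick_matrix lambda w) ->
  forall e : R, 0 < e -> exists f : fock R I -> fock R I,
    [/\ disc_algebra f, (opnorm f <= (1 + e)%:E)%E &
        forall j, point_eval f (lambda j) = w j].
Proof.
move=> /(pick_colligation lambda1)[a [b [c [d [B [ctr Ba Bb]]]]]] e e0.
have approx := approximate_interpolation lambda1 ctr Ba Bb.
have w_lambda i j : lambda i = lambda j -> w i = w j.
  move=> lij; apply/eqP; rewrite -subr_eq0; apply/eqP.
  apply: ComplexField.Normc.eq0_normc; apply/eqP; rewrite eq_le normc_ge0 andbT.
  apply/ler_addgt0Pr => t t0; rewrite add0r.
  have [f [_ _ fE]] := approx (t / 2) (divr_gt0 t0 (ltr0n _ 2)).
  have -> : w i - w j = (w i - point_eval f (lambda i)) - (w j - point_eval f (lambda i)).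
    by ring.
  apply: le_trans (le_normcD _ _) _; rewrite normcN [leRHS]splitr lerD//.
  by rewrite lij; exact: fE.
have [f [df f_le fE]] := interpolation_correction w_lambda approx e0.
exists f; split => //; have [fL _] := disc_algebra_bounded df.
by apply/opnorm_leP => //; rewrite addr_ge0// ltW.
Qed.

End Pick.

Theorem corollary2p13 (R : realType) (I : countType)
    (I_neq0 : [set: I] !=set0) (k : nat)
    (lambda : 'I_k -> ell2 R I) (lambda_ball : forall j, `|lambda j| < 1)
    (w : 'I_k -> R[i]) :
  posdefmx (\matrix_(i < k, j < k)
    ((1 - w j * (w i)^*) / (1 - inner (lambda j) (lambda i)))) <->
  (forall e : R, 0 < e -> exists f : fock R I -> fock R I,
    [/\ disc_algebra f, (opnorm f <= (1 + e)%:E)%E &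
        forall j, point_eval f (lambda j) = w j]).
Proof.
have lambda1 j : ell2_norm (lambda j) < 1.
  by have := lambda_ball j; rewrite ell2_normE -[1]/(1%:C%C) ltcR.
split; first exact: interpolant_of_posdef.
exact: posdef_pick_matrix.
Qed.
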